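(* Let $K\in\mathcal{K}_0$. For all $\phi\in\Phi$ or $\phi\in\Psi$, one has $$\Omega_\phi^{orlicz}(TK)=\Omega_\phi^{orlicz}(K),\qquad G_\phi^{orlicz}(TK)=G_\phi^{orlicz}(K),\qquad \forall\, T\in SL(n).$$
   Context: A convex body is a convex compact subset of $\mathbb{R}^n$ with nonempty interior. $\mathcal{K}_0$ is the set of convex bodies with the origin in their interior; $h_K(u)=\max_{x\in K}\langle x,u\rangle$ is the support function; $K^\circ=\{y:\langle x,y\rangle\le 1\ \forall x\in K\}$ is the polar body; $|\cdot|$ is volume; $B_2^n$ is the unit Euclidean ball and $\omega_n=|B_2^n|$; $S(K,\cdot)$ is the (classical) surface area measure of $K$ on $S^{n-1}$. $\mathcal{S}_0$ is the set of star bodies about the origin: sets $L$ containing the segment from $0$ to each of their points and whose radial function $\rho_L(u)=\max\{\lambda:\lambda u\in L\}$ is continuous and positive on $S^{n-1}$. $SL(n)$ is the set of linear maps $T$ of $\mathbb{R}^n$ with $|\det T|=1$ (absolute value of the determinant); $TK=T(K)$. For continuous $\phi:(0,\infty)\to(0,\infty)$, $K,Q\in\mathcal{K}_0$, $L\in\mathcal{S}_0$: $$V_\phi(K,Q)=\frac1n\int_{S^{n-1}}\phi\Big(\frac{h_Q(u)}{h_K(u)}\Big)h_K(u)\,dS(K,u),\quad V_\phi(K,L^\circ)=\frac1n\int_{S^{n-1}}\phi\Big(\frac{1}{\rho_L(u)h_K(u)}\Big)h_K(u)\,dS(K,u).$$ With $F_\phi(t)=\phi(t^{-1/n})$: $\Phi$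 is the set of $\phi:(0,\infty)\to(0,\infty)$ such that $F_\phi$ is either constant or strictly convex; $\Psi$ is the set of $\phi:(0,\infty)\to(0,\infty)$ such that $F_\phi$ is either constant or increasing and strictly concave. For $K\in\mathcal{K}_0$ and $\phi\in\Phi$: $\Omega_\phi^{orlicz}(K)=\inf\{nV_\phi(K,L^\circ):L\in\mathcal{S}_0,|L|=\omega_n\}$ and $G_\phi^{orlicz}(K)=\inf\{nV_\phi(K,Q):Q\in\mathcal{K}_0,|Q^\circ|=\omega_n\}$. For $\phi\in\Psi$ the same definitions with $\sup$ in place of $\inf$ (value $+\infty$ allowed). *)

(* Defs.v *)
From HB Require Import structures.
From mathcomp Require Import all_boot all_order all_algebra.
From mathcomp Require Import all_classical all_reals all_analysis.

Set Implicit Arguments.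
Unset Strict Implicit.
Unset Printing Implicit Defensive.

Import Order.TTheory GRing.Theory Num.Theory.
Import numFieldNormedType.Exports.

Local Open Scope classical_set_scope.
Local Open Scope ring_scope.

Section euclidean.
Context {R : realType} {n : nat}.
Implicit Types (u v x y : 'rV[R]_n) (A : set 'rV[R]_n) (T : 'M[R]_n).

Definition dot u v : R := \sum_(i < n) u ord0 i * v ord0 i.

(* The library norm on 'rV[R]_n is the sup norm; it induces the same topology,
   but the sphere, the ball and diameters must be Euclidean. *)
Definition enorm u : R := Num.sqrt (dot u u).

Definition sphere : set 'rV[R]_n := [set u | enorm u = 1].

Definition unit_ball : set 'rV[R]_n := [set x | enorm x <= 1].

(* A matrix T stands for the linear map x |-> x *m T on row vectors. *)
Definition lin_image T A : set 'rV[R]_n := [set x *m T | x in A].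

Definition SL T : Prop := `|\det T| = 1.

Definition ediam A : \bar R :=
  ereal_sup [set e | exists x y, [/\ A x, A y & e = (enorm (x - y))%:E]].

End euclidean.

Arguments sphere R n : clear implicits.
Arguments unit_ball R n : clear implicits.

(* n-fold product of the one-dimensional Lebesgue measure, by iterated
   integration as in the library's product_measure1.  It is Lebesgue measure
   on Borel sets; it is only used on compact sets below. *)
Fixpoint vol {R : realType} (n : nat) : set 'rV[R]_n -> \bar R :=
  match n with
  | 0 => fun A => (\1_A 0)%:E
  | m.+1 => fun A =>
      (\int[@lebesgue_measure R]_t
         vol [set x : 'rV[R]_m | A (row_mx (t%:M : 'rV[R]_1) x)])%E
  end.

Definition omega (R : realType) (n : nat) : \bar R := vol (unit_ball R n).

Section hausdorff.
Context {R : realType} {n : nat}.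
Variable m : nat.
Implicit Types A : set 'rV[R]_n.
Local Open Scope ereal_scope.

(* Volume of the m-dimensional ball whose diameter is that of A.  The empty set
   is separated so that H^0 is the counting measure. *)
Definition hausdorff_gauge A : \bar R :=
  if A == set0 then 0 else omega R m * (ediam A * (2^-1)%:E) ^+ m.

Definition hausdorff_pre (delta : R) A : \bar R :=
  ereal_inf [set \sum_(k <oo) hausdorff_gauge (C k) | C in
    [set C : nat -> set 'rV[R]_n |
      A `<=` \bigcup_k C k /\ forall k, ediam (C k) <= delta%:E]].

(* The m-dimensional Hausdorff (outer) measure, normalized so that it agrees
   with Lebesgue measure on m-dimensional planes. *)
Definition hausdorff A : \bar R :=
  ereal_sup [set hausdorff_pre delta A | delta in [set d : R | (0 < d)%R]].

End hausdorff.

Section bodies.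
Context {R : realType} {n : nat}.
Implicit Types (u v x y : 'rV[R]_n) (K L A : set 'rV[R]_n).

Definition convex_body K : Prop :=
  [/\ convex_set K, compact K & K° !=set0].

Definition K0 K : Prop := convex_body K /\ K° 0.

Definition support_fun K u : R := sup [set dot x u | x in K].

Definition polar K : set 'rV[R]_n :=
  [set y | forall x, K x -> dot x y <= 1].

Definition radial_fun L u : R := sup [set l : R | L (l *: u)].

(* The second clause says that the supremum defining the radial function is a
   maximum. *)
Definition S0 L : Prop :=
  [/\ forall x (t : R), L x -> 0 <= t <= 1 -> L (t *: x),
      forall u, sphere R n u ->
        L (radial_fun L u *: u) /\
        ubound [set l : R | L (l *: u)] (radial_fun L u),
      {within sphere R n, continuous (radial_fun L)} &
      forall u, sphere R n u -> 0 < radial_fun L u].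

Definition outer_normal K x u : Prop :=
  [/\ K x, sphere R n u & forall y, K y -> dot y u <= dot x u].

(* Preimage under the Gauss map, which is defined at the boundary points with
   exactly one outer unit normal. *)
Definition gauss_preimage K A : set 'rV[R]_n :=
  [set x | exists2 u, A u & forall v, outer_normal K x v <-> v = u].

Definition borel_rV := g_sigma_algebraType (@open 'rV[R]_n).

Definition surface_area (K : set 'rV[R]_n) (A : set borel_rV) : \bar R :=
  hausdorff n.-1 (gauss_preimage K A).

End bodies.

Section orlicz.
Context {R : realType} {n : nat}.
Implicit Types (phi : R -> R) (K L Q : set 'rV[R]_n).

Definition Vphi phi K Q : \bar R :=
  ((n%:R^-1)%:E * \int[surface_area K]_(u in sphere R n)
     (phi (support_fun Q u / support_fun K u) * support_fun K u)%:E)%E.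

(* V_phi(K, L°), where 1 / rho_L plays the role of the support function of L°
   (L need not be convex). *)
Definition Vphi_star phi K L : \bar R :=
  ((n%:R^-1)%:E * \int[surface_area K]_(u in sphere R n)
     (phi (1 / (radial_fun L u * support_fun K u)) * support_fun K u)%:E)%E.

Definition Omega_values phi K : set (\bar R) :=
  [set (n%:R%:E * Vphi_star phi K L)%E | L in
    [set L | S0 L /\ vol L = omega R n]].

Definition G_values phi K : set (\bar R) :=
  [set (n%:R%:E * Vphi phi K Q)%E | Q in
    [set Q | K0 Q /\ vol (polar Q) = omega R n]].

(* The infimum is the definition for phi in Phi, the supremum for phi in Psi. *)
Definition Omega_inf phi K : \bar R := ereal_inf (Omega_values phi K).
Definition Omega_sup phi K : \bar R := ereal_sup (Omega_values phi K).
Definition G_inf phi K : \bar R := ereal_inf (G_values phi K).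
Definition G_sup phi K : \bar R := ereal_sup (G_values phi K).

End orlicz.

(* Functions on (0, oo) are represented by functions on R whose values outside
   (0, oo) are irrelevant. *)
Section classes.
Context {R : realType}.
Variable n : nat.
Implicit Types (phi F : R -> R).

Definition F_of phi : R -> R := fun t => phi (t `^ (- n%:R^-1)).

Definition constant_pos F : Prop := exists c, forall t, 0 < t -> F t = c.

Definition strictly_convex_pos F : Prop :=
  forall s t l : R, 0 < s -> 0 < t -> s != t -> 0 < l < 1 ->
    F (l * s + (1 - l) * t) < l * F s + (1 - l) * F t.

Definition strictly_concave_pos F : Prop :=
  strictly_convex_pos (fun t => - F t).

Definition increasing_pos F : Prop :=
  forall s t : R, 0 < s -> s < t -> F s < F t.

Definition Phi phi : Prop :=
  (forall t, 0 < t -> 0 < phi t) /\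
  (constant_pos (F_of phi) \/ strictly_convex_pos (F_of phi)).

Definition Psi phi : Prop :=
  (forall t, 0 < t -> 0 < phi t) /\
  (constant_pos (F_of phi) \/
   (increasing_pos (F_of phi) /\ strictly_concave_pos (F_of phi))).

End classes.

(* Main.v *)
(* Write N(u) = u T^-t / w(u) with w(u) = |u T^-t| (row vectors, T acts by
   x |-> x T).  If u is the unit normal of K at x, then N(u) is the unit normal
   of K T at x T, and h_{KT}(N(u)) = h_K(u) / w(u); the same holds for h_Q
   when Q is replaced by Q T, and rho_{L T^-t}(N(u)) = w(u) rho_L(u).  So the
   arguments of phi agree at u and N(u), the volume constraints are preserved,
   and everything reduces to dS(K T, N(u)) = w(u) dS(K, u).

   Only the inequality <= is proved; applying it to T^-1 gives equality.  Let E
   be the set of boundary points of K whose normal is within delta of u0.  By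
   convexity the chords of E make an angle O(delta) with the hyperplane
   orthogonal to u0, so that projecting E and E T to the hyperplanes orthogonal
   to u0 and N(u0) changes H^(n-1) by a factor 1 + O(delta), and T multiplies
   H^(n-1) by w(u0) between these hyperplanes.  A partition of the sphere into
   small pieces and delta -> 0 conclude.

   On hyperplanes, H^(n-1) is compared with Lebesgue measure: two translation
   invariant sigma-finite Borel measures are proportional, by Fubini.  The same
   principle shows that a linear map multiplies volumes by |det|. *)
From HB Require Import structures.
From mathcomp Require Import all_boot all_order all_algebra fingroup perm.
From mathcomp Require Import all_classical all_reals all_analysis.
From mathcomp Require Import measurable_realfun ring lra zify.
Require Import Defs.

Set Implicit Arguments.
Unset Strict Implicit.
Unset Printing Implicit Defensive.

Import Order.TTheory GRing.Theory Num.Theory.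
Import numFieldNormedType.Exports.

Local Open Scope classical_set_scope.
Local Open Scope ring_scope.

(** * Euclidean structure and Borel sets of row vectors *)

(** The obstacle is measurability. The integrands involve [phi] and are not shown to be measurable,
    nor is the set of boundary points with a unique normal shown to be Borel. The area estimates are
    therefore upper bounds valid for arbitrary sets: Lipschitz maps, Borel hulls and countable
    coverings bound an outer measure from above only, which is why an inequality comes out and the
    inverse map has to supply the converse. Integrals are compared through the simple functions
    below the integrand, whose level sets are Borel. Surface area is nevertheless a measure on Borel
    sets, because H^(n-1) is a metric outer measure. On a hyperplane the ratio of H^(n-1) to
    Lebesgue measure stays undetermined: it occurs on both sides and cancels. *)

Lemma lipschitz_continuous (R : realType) (V W : normedModType R) (f : V -> W)
    (C : R) : (forall x y, `|f x - f y| <= C * `|x - y|) -> continuous f.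
Proof.
move=> fC x; apply/cvgrPdist_lt => e e0; apply/nbhs_ballP.
have C0 : 0 < `|C| + 1 by rewrite ltr_pwDr.
exists (e / (`|C| + 1)) => [|y]/=; first by rewrite divr_gt0.
rewrite -ball_normE/= ltr_pdivlMr// mulrC; apply: le_lt_trans.
apply: (le_trans (fC _ _)); rewrite ler_wpM2r//.
by rewrite (le_trans (ler_norm _))// lerDl.
Qed.

Section euclid.
Context {R : realType} {n : nat}.
Implicit Types (u v w x y : 'rV[R]_n) (a : R).

Lemma dot_mxE u v : dot u v = (u *m v^T) ord0 ord0.
Proof. by rewrite mxE; apply: eq_bigr => i _; rewrite !mxE. Qed.

Lemma dotC u v : dot u v = dot v u.
Proof. by apply: eq_bigr => i _; rewrite mulrC. Qed.

Lemma dotDl u v w : dot (u + v) w = dot u w + dot v w.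
Proof. by rewrite !dot_mxE mulmxDl mxE. Qed.

Lemma dotZl a u v : dot (a *: u) v = a * dot u v.
Proof. by rewrite !dot_mxE -scalemxAl mxE. Qed.

Lemma dotNl u v : dot (- u) v = - dot u v.
Proof. by rewrite -scaleN1r dotZl mulN1r. Qed.

Lemma dotBl u v w : dot (u - v) w = dot u w - dot v w.
Proof. by rewrite dotDl dotNl. Qed.

Lemma dotDr u v w : dot w (u + v) = dot w u + dot w v.
Proof. by rewrite dotC dotDl !(dotC w). Qed.

Lemma dotZr a u v : dot u (a *: v) = a * dot u v.
Proof. by rewrite dotC dotZl dotC. Qed.

Lemma dotNr u v : dot u (- v) = - dot u v.
Proof. by rewrite dotC dotNl dotC. Qed.

Lemma dotBr u v w : dot w (u - v) = dot w u - dot w v.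
Proof. by rewrite dotDr dotNr. Qed.

Lemma dot0l u : dot 0 u = 0.
Proof. by rewrite -(scale0r u) dotZl mul0r. Qed.

Lemma dot_ge0 u : 0 <= dot u u.
Proof. by apply: sumr_ge0 => i _; rewrite -expr2 sqr_ge0. Qed.

Lemma enorm_ge0 u : 0 <= enorm u.
Proof. exact: sqrtr_ge0. Qed.

Lemma enorm_sqr u : enorm u ^+ 2 = dot u u.
Proof. by rewrite sqr_sqrtr// dot_ge0. Qed.

Lemma enorm0 : enorm (0 : 'rV[R]_n) = 0.
Proof. by rewrite /enorm dot0l sqrtr0. Qed.

Lemma enorm_coord_le u (i : 'I_n) : `|u ord0 i| <= enorm u.
Proof.
rewrite -(@ler_pXn2r _ 2)// ?nnegrE ?enorm_ge0// enorm_sqr real_normK ?num_real//.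
rewrite /dot (bigD1 i)//= -expr2 lerDl.
by apply: sumr_ge0 => j _; rewrite -expr2 sqr_ge0.
Qed.

Lemma enorm_eq0 u : enorm u = 0 -> u = 0.
Proof.
move=> u0; apply/rowP => i; rewrite mxE; apply/eqP; rewrite -normr_le0.
by rewrite -u0; exact: enorm_coord_le.
Qed.

Lemma enorm_gt0 u : u != 0 -> 0 < enorm u.
Proof.
move=> u0; rewrite lt_neqAle enorm_ge0 andbT eq_sym.
by apply: contra u0 => /eqP /enorm_eq0 ->.
Qed.

Lemma enormZ a u : enorm (a *: u) = `|a| * enorm u.
Proof.
by rewrite /enorm dotZl dotZr mulrA -expr2 sqrtrM ?sqr_ge0// sqrtr_sqr.
Qed.

Lemma enormN u : enorm (- u) = enorm u.
Proof. by rewrite -scaleN1r enormZ normrN1 mul1r. Qed.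

Lemma enormBC u v : enorm (u - v) = enorm (v - u).
Proof. by rewrite -enormN opprB. Qed.

(** Cauchy-Schwarz: the squared length of [enorm v *: u - enorm u *: v] is twice pq(pq - r), with p,
    q the two norms and r the scalar product. *)
Lemma dot_le_enorm u v : dot u v <= enorm u * enorm v.
Proof.
have [->|u0] := eqVneq u 0; first by rewrite dot0l enorm0 mul0r.
have [->|v0] := eqVneq v 0; first by rewrite dotC dot0l enorm0 mulr0.
have := dot_ge0 (enorm v *: u - enorm u *: v).
rewrite dotBl !dotBr !dotZl !dotZr -!enorm_sqr (dotC v u).
have := enorm_gt0 u0; have := enorm_gt0 v0.
move: (enorm u) (enorm v) (dot u v) => p q r q0 p0 H.
have : 0 <= (p * q) * (p * q - r) by lra.
by rewrite pmulr_rge0 ?mulr_gt0// subr_ge0.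
Qed.

Lemma norm_dot_le_enorm u v : `|dot u v| <= enorm u * enorm v.
Proof.
by rewrite ler_norml dot_le_enorm andbT lerNl -dotNl -(enormN u) dot_le_enorm.
Qed.

Lemma ler_enormD u v : enorm (u + v) <= enorm u + enorm v.
Proof.
rewrite -(@ler_pXn2r _ 2)// ?nnegrE ?addr_ge0 ?enorm_ge0//.
rewrite enorm_sqr dotDl !dotDr sqrrD -!enorm_sqr (dotC v u).
have := dot_le_enorm u v; lra.
Qed.

Lemma ler_enormB u v w : enorm (u - w) <= enorm (u - v) + enorm (v - w).
Proof. by apply: le_trans (ler_enormD _ _); rewrite addrA subrK. Qed.

Lemma ler_dist_enorm u v : `|enorm u - enorm v| <= enorm (u - v).
Proof.
rewrite ler_norml; apply/andP; split.
  rewrite lerNl opprB lerBlDr enormBC -{1}(subrK u v); exact: ler_enormD.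
rewrite lerBlDr -{1}(subrK v u); exact: ler_enormD.
Qed.

Lemma norm_le_enorm u : `|u| <= enorm u.
Proof.
rewrite [leLHS]/Num.norm/= mx_normrE; apply/bigmax_leP; split; first exact: enorm_ge0.
by move=> [i j] _ /=; rewrite ord1; exact: enorm_coord_le.
Qed.

Lemma coord_le_norm u (i : 'I_n) : `|u ord0 i| <= `|u|.
Proof.
rewrite [leRHS]/Num.norm/= mx_normrE; apply/bigmax_geP; right.
by exists (ord0, i).
Qed.

(** The factor n is cruder than its square root, but the bound serves only to pass between
    equivalent norms. *)
Lemma enorm_le_norm u : enorm u <= n%:R * `|u|.
Proof.
rewrite -(@ler_pXn2r _ 2)// ?nnegrE ?enorm_ge0 ?mulr_ge0//.
rewrite enorm_sqr exprMn.
apply: (@le_trans _ _ (\sum_(i < n) `|u| ^+ 2)).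
  apply: ler_sum => i _; rewrite -expr2 -[leLHS]real_normK ?num_real//.
  by rewrite ler_pXn2r ?nnegrE// coord_le_norm.
rewrite sumr_const card_ord -[leLHS]mulr_natl ler_wpM2r ?sqr_ge0// -natrX ler_nat.
by case: (n) => // k; rewrite -mulnn leq_pmulr.
Qed.

Lemma enorm_continuous : continuous (@enorm R n).
Proof.
apply: (@lipschitz_continuous _ _ _ _ n%:R) => u v.
exact: le_trans (ler_dist_enorm _ _) (enorm_le_norm _).
Qed.

Lemma dot_continuous u : continuous (fun v => dot v u).
Proof.
apply: (@lipschitz_continuous _ _ _ _ (n%:R * enorm u)) => v w.
rewrite -dotBl (le_trans (norm_dot_le_enorm _ _))// mulrAC.
by rewrite ler_wpM2r ?enorm_ge0// enorm_le_norm.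
Qed.

End euclid.

Section linear_maps.
Context {R : realType}.

Lemma dot_mulmx m n (u : 'rV[R]_m) (T : 'M[R]_(m, n)) (v : 'rV[R]_n) :
  dot (u *m T) v = dot u (v *m T^T).
Proof. by rewrite !dot_mxE trmx_mul trmxK mulmxA. Qed.

(** Cauchy-Schwarz on each column gives the Frobenius norm of [T]; adding 1 keeps the constant
    positive when [T] vanishes. *)
Lemma enorm_mulmx_bound m n (T : 'M[R]_(m, n)) :
  {C : R | 0 < C & forall x : 'rV[R]_m, enorm (x *m T) <= C * enorm x}.
Proof.
pose S := \sum_(j < n) enorm (row j T^T) ^+ 2.
have S0 : 0 <= S by apply: sumr_ge0 => j _; rewrite sqr_ge0.
exists (Num.sqrt S + 1) => [|x]; first by rewrite ltr_pwDr// sqrtr_ge0.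
apply: (@le_trans _ _ (Num.sqrt S * enorm x)); last first.
  by rewrite ler_wpM2r ?enorm_ge0// lerDl.
rewrite -(@ler_pXn2r _ 2)// ?nnegrE ?mulr_ge0 ?enorm_ge0 ?sqrtr_ge0//.
rewrite enorm_sqr exprMn sqr_sqrtr// mulr_suml; apply: ler_sum => j _.
have -> : (x *m T) ord0 j = dot x (row j T^T).
  by rewrite mxE; apply: eq_bigr => k _; rewrite !mxE.
rewrite -expr2 -[leLHS]real_normK ?num_real// -exprMn.
by rewrite ler_pXn2r ?nnegrE ?mulr_ge0 ?enorm_ge0// mulrC norm_dot_le_enorm.
Qed.

Lemma mulmx_continuous m n (T : 'M[R]_(m, n)) :
  continuous (fun x : 'rV[R]_m => x *m T).
Proof.
have [C C0 CT] := enorm_mulmx_bound T.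
apply: (@lipschitz_continuous _ _ _ _ (C * m%:R)) => x y.
rewrite -mulmxBl (le_trans (norm_le_enorm _))// (le_trans (CT _))// -mulrA.
by rewrite ler_wpM2l ?(ltW C0)// enorm_le_norm.
Qed.

Lemma lin_image_comp n (S T : 'M[R]_n) (A : set 'rV[R]_n) :
  lin_image T (lin_image S A) = lin_image (S *m T) A.
Proof.
rewrite /lin_image; apply/seteqP; split => [_ [_ [x Ax <-] <-]|_ [x Ax <-]].
  by exists x => //; rewrite mulmxA.
by exists (x *m S); [exists x|rewrite mulmxA].
Qed.

Lemma lin_image1 n (A : set 'rV[R]_n) : lin_image 1%:M A = A.
Proof.
rewrite /lin_image; apply/seteqP; split => [_ [x Ax <-]|x Ax]; rewrite ?mulmx1//.
by exists x; rewrite ?mulmx1.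
Qed.

Lemma lin_imageE n (T : 'M[R]_n) (A : set 'rV[R]_n) : T \in unitmx ->
  lin_image T A = [set y | A (y *m invmx T)].
Proof.
move=> Tu; apply/seteqP; split => [_ [x Ax <-]|y Ay]/=; first by rewrite mulmxK.
by exists (y *m invmx T) => //; rewrite mulmxKV.
Qed.

Lemma SL_unitmx n (T : 'M[R]_n) : SL T -> T \in unitmx.
Proof. by move=> detT; rewrite unitmxE unitfE -normr_gt0 detT. Qed.

Lemma SL_invmx n (T : 'M[R]_n) : SL T -> SL (invmx T).
Proof. by move=> detT; rewrite /SL det_inv normfV detT invr1. Qed.

End linear_maps.

(** * Countable dense sets and open sets of products *)

Section countable_base.
Context {R : realType}.

Lemma open_bigcup_ball (X : pseudoMetricType R) (D : nat -> X)
    (D_dense : forall x (e : R), 0 < e -> exists k, ball (D k) e x) (U : set X) :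
  open U ->
  U = \bigcup_i \bigcup_(j in [set j | ball (D i) j.+1%:R^-1 `<=` U])
        ball (D i) j.+1%:R^-1.
Proof.
move=> Uo; apply/seteqP; split => [x Ux|x [i _] [j /= + ?]]; last exact.
have /nbhs_ballP[e /= e0 xeU] : nbhs x U by exact: open_nbhs_nbhs.
have [j je] : exists j, j.+1%:R^-1 < e / 2.
  have /ltr_add_invr[j] : 0 < e / 2 by rewrite divr_gt0.
  by rewrite add0r => ?; exists j.
have [|i Dix] := D_dense x j.+1%:R^-1; first by rewrite invr_gt0.
exists i => //; exists j => //= y Diy; apply: xeU.
rewrite (splitr e); apply: ball_triangle (le_ball (ltW je) Diy).
exact/ball_sym/(le_ball (ltW je) Dix).
Qed.

Definition rat_point n (k : nat) : 'rV[R]_n :=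
  map_mx ratr (odflt (0 : 'rV[rat]_n) (unpickle k)).

Lemma rat_point_dense n (x : 'rV[R]_n) e :
  0 < e -> exists k, ball (rat_point n k) e x.
Proof.
move=> e0.
have /choice[q qP] (i : 'I_n) : exists q : rat, `|ratr q - x ord0 i| < e.
  have /rat_in_itvoo[q] : x ord0 i - e < x ord0 i + e by lra.
  rewrite in_itv/= => /andP[? ?]; exists q; rewrite ltr_norml; apply/andP; lra.
exists (pickle (\row_i q i)); rewrite /rat_point pickleK/=; split => // i j.
by rewrite ord1 !mxE; exact: qP.
Qed.

Definition rat_real (k : nat) : R := ratr (odflt (0 : rat) (unpickle k)).

Lemma rat_real_dense (x e : R) : 0 < e -> exists k, ball (rat_real k) e x.
Proof.
move=> e0; have /rat_in_itvoo[q] : x - e < x + e by lra.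
rewrite in_itv/= => /andP[? ?]; exists (pickle q).
rewrite /rat_real pickleK -ball_normE/= ltr_norml; apply/andP; lra.
Qed.

Lemma dense_prod (X Y : pseudoMetricType R) (D : nat -> X) (E : nat -> Y) :
  (forall x (e : R), 0 < e -> exists k, ball (D k) e x) ->
  (forall x (e : R), 0 < e -> exists k, ball (E k) e x) ->
  let DE k := let p := odflt (0%N, 0%N) (unpickle k) in (D p.1, E p.2) in
  forall x (e : R), 0 < e -> exists k, ball (DE k) e x.
Proof.
move=> DP EP DE [x y] e e0; have [i Di] := DP x e e0; have [j Ej] := EP y e e0.
by exists (pickle (i, j)); rewrite /DE pickleK.
Qed.

(** By separability an open set of the product is a countable union of products of balls. The maps
    [f] and [g], identities in every use, relate the types carrying sigma-algebras to those carrying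
    metrics. *)
Lemma open_prod_measurable (X Y : pseudoMetricType R) dX dY
    (mX : measurableType dX) (mY : measurableType dY)
    (f : mX -> X) (g : mY -> Y) (D : nat -> X) (E : nat -> Y) :
  (forall x (e : R), 0 < e -> exists k, ball (D k) e x) ->
  (forall x (e : R), 0 < e -> exists k, ball (E k) e x) ->
  (forall x (e : R), measurable (f @^-1` ball x e)) ->
  (forall x (e : R), measurable (g @^-1` ball x e)) ->
  forall W : set (X * Y), open W ->
  measurable [set p : mX * mY | W (f p.1, g p.2)].
Proof.
move=> DP EP mf mg W Wo.
pose DE k := let p := odflt (0%N, 0%N) (unpickle k) in (D p.1, E p.2).
pose r j : R := j.+1%:R^-1.
suff -> : [set p : mX * mY | W (f p.1, g p.2)] =
    \bigcup_i \bigcup_(j in [set j | ball (DE i) (r j) `<=` W])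
      ((f @^-1` ball (DE i).1 (r j)) `*` (g @^-1` ball (DE i).2 (r j))).
  apply: bigcup_measurable => i _; apply: bigcup_measurable => j _.
  by apply: measurableX; [exact: mf|exact: mg].
rewrite [in LHS](open_bigcup_ball (dense_prod DP EP) Wo).
by apply/seteqP; split => [p [i _ [j iW pij]]|p [i _ [j iW pij]]];
  exists i => //; exists j; [exact: iW|exact: pij|exact: iW|exact: pij].
Qed.

End countable_base.

Section borel.
Context {R : realType} {n : nat}.
Local Notation borel := (@borel_rV R n).

Lemma open_borel (U : set borel) : open (U : set 'rV[R]_n) -> measurable U.
Proof. by move=> Uo; exact: sub_sigma_algebra. Qed.

Lemma closed_borel (F : set borel) : closed (F : set 'rV[R]_n) -> measurable F.
Proof.
move=> Fc; rewrite -(setCK F); apply: measurableC; apply: open_borel.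
exact: closed_openC.
Qed.

Lemma borel_ind (P : set (set 'rV[R]_n)) : sigma_algebra setT P ->
  (forall U, open U -> P U) -> forall A : set borel, measurable A -> P A.
Proof. by move=> Ps Po; apply: smallest_sub. Qed.

Lemma continuous_borel m (f : 'rV[R]_n -> 'rV[R]_m) :
  continuous f -> measurable_fun setT (f : borel -> @borel_rV R m).
Proof.
move=> fc; apply: (@measurability _ _ borel (@borel_rV R m) _ _ (@open 'rV[R]_m)) => //.
move=> _ [U Uo <-]; rewrite setTI; apply: open_borel.
by apply: open_comp => // ? _; exact: fc.
Qed.

End borel.

(** * Hausdorff measure *)

Section ereal_facts.
Context {R : realType}.
Local Open Scope ereal_scope.

Lemma lee_expe (x y : \bar R) m : 0 <= x -> x <= y -> x ^+ m <= y ^+ m.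
Proof.
move=> x0 xy; elim: m => [|m ih]; first by rewrite !expe0.
by rewrite !expeS lee_pmul// expe_ge0.
Qed.

Lemma expeM (x y : \bar R) m : (x * y) ^+ m = x ^+ m * y ^+ m.
Proof.
elim: m => [|m ih]; first by rewrite !expe0 mule1.
by rewrite !expeS ih muleACA.
Qed.

(** Lets the two scales in [hausdorff_metric] vary one after the other; an infinite [y] is treated
    apart because it cannot be subtracted. *)
Lemma adde_ereal_sup_le (S : set (\bar R)) (y z : \bar R) : 0 <= y ->
  S !=set0 -> (forall x, S x -> x + y <= z) -> ereal_sup S + y <= z.
Proof.
move=> y0 [x0 Sx0] H; case: y y0 H => [y| |] y0 H //; last first.
  have [->|z_lty] := eqVneq z +oo; first by rewrite leey.
  case: (eqVneq (ereal_sup S) -oo) => [->|sN]; first by rewrite addNye leNye.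
  have [x Sx xN] : exists2 x, S x & x != -oo.
    apply/not_exists2P => allN; move/eqP : sN; apply.
    apply/ereal_sup_ninfty => x Sx.
    by case: (allN x) => // /negP; rewrite negbK => /eqP.
  by have := H _ Sx; rewrite addey// leye_eq (negbTE z_lty).
rewrite -leeBrDr//; apply: ge_ereal_sup => x Sx.
by rewrite leeBrDr//; exact: H.
Qed.

End ereal_facts.

Section vol_omega.
Context {R : realType}.
Local Open Scope ereal_scope.

Lemma vol_ge0 n (A : set 'rV[R]_n) : 0 <= vol A.
Proof.
elim: n A => [|n ih] A /=; first by rewrite lee_fin indicE.
by apply: integral_ge0 => t _; exact: ih.
Qed.

Lemma omega_ge0 n : 0 <= omega R n.
Proof. exact: vol_ge0. Qed.

End vol_omega.

Section diameter.
Context {R : realType} {n : nat}.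
Implicit Types (A B : set 'rV[R]_n).
Local Open Scope ereal_scope.

Lemma ediam_le A (d : \bar R) :
  (forall x y, A x -> A y -> (enorm (x - y))%:E <= d) -> ediam A <= d.
Proof. by move=> H; apply: ge_ereal_sup => e [x [y [Ax Ay ->]]]; exact: H. Qed.

Lemma le_ediam_point A x y : A x -> A y -> (enorm (x - y))%:E <= ediam A.
Proof. by move=> Ax Ay; apply: ereal_sup_ubound; exists x, y. Qed.

Lemma ediam0 : ediam (set0 : set 'rV[R]_n) = -oo.
Proof. by apply/ereal_sup_ninfty => e [x [y []]]. Qed.

Lemma le_ediam A B : A `<=` B -> ediam A <= ediam B.
Proof. by move=> AB; apply: ediam_le => x y /AB Bx /AB By; exact: le_ediam_point. Qed.

Lemma ediam_ge0 A : A !=set0 -> 0 <= ediam A.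
Proof.
by move=> [x Ax]; apply: le_trans (le_ediam_point Ax Ax); rewrite lee_fin enorm_ge0.
Qed.

End diameter.

Lemma ediam_image_le (R : realType) n n' (f : 'rV[R]_n -> 'rV[R]_n') (L : R)
    (A : set 'rV[R]_n) : 0 <= L ->
  (forall x y, A x -> A y -> enorm (f x - f y) <= L * enorm (x - y)) ->
  A !=set0 -> (ediam (f @` A) <= L%:E * ediam A)%E.
Proof.
move=> L0 fL A0; apply: ediam_le => _ _ [x Ax <-] [y Ay <-].
apply: (@le_trans _ _ (L%:E * (enorm (x - y))%:E)%E); first by rewrite -EFinM lee_fin fL.
by rewrite lee_wpmul2l ?lee_fin// le_ediam_point.
Qed.

(* The sets of diameter at most delta form a semiring, so that the
   delta-approximation of the Hausdorff measure is an instance of the library's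
   outer measure construction. *)
Definition small_sets (R : realType) (n : nat) (delta : R) := 'rV[R]_n.

Section small_sets.
Context {R : realType} {n : nat} (delta : R).
Let small := [set A : set (small_sets n delta) | (ediam (A : set 'rV[R]_n) <= delta%:E)%E].

Let small0 : small set0.
Proof. by rewrite /small/= ediam0 leNye. Qed.

Let smallI : setI_closed small.
Proof. by move=> A B sA sB; apply: le_trans sA; apply: le_ediam; exact: subIsetl. Qed.

Let smallD : semi_setD_closed small.
Proof.
apply: setD_semi_setD_closed => A B sA sB.
by apply: le_trans sA; apply: le_ediam; exact: subDsetl.
Qed.

HB.instance Definition _ := Pointed.on (small_sets n delta).
HB.instance Definition _ := @isSemiRingOfSets.Build default_measure_display
  (small_sets n delta) small small0 smallI smallD.

End small_sets.

Section hausdorff_outer.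
Context {R : realType} {n : nat} (m : nat).
Implicit Types (A B : set 'rV[R]_n) (delta : R).
Local Open Scope ereal_scope.
Local Notation gauge := (@hausdorff_gauge R n m).

Lemma hausdorff_gauge0 : gauge set0 = 0.
Proof. by rewrite /hausdorff_gauge eqxx. Qed.

Lemma hausdorff_gauge_ge0 A : 0 <= gauge A.
Proof.
rewrite /hausdorff_gauge; case: ifPn => // /set0P A0.
by rewrite mule_ge0 ?omega_ge0// expe_ge0// mule_ge0 ?ediam_ge0// lee_fin invr_ge0.
Qed.

Lemma le_hausdorff_gauge_ediam A B : A !=set0 -> ediam A <= ediam B ->
  gauge A <= gauge B.
Proof.
move=> A0 AB; rewrite /hausdorff_gauge.
have [A_0|_] := eqVneq A set0; first by move: A0; rewrite A_0 => -[].
have [B_0|_] := eqVneq B set0.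
  by have := le_trans (ediam_ge0 A0) AB; rewrite B_0 ediam0.
rewrite lee_wpmul2l ?omega_ge0// lee_expe ?mule_ge0 ?ediam_ge0 ?lee_fin ?invr_ge0//.
by rewrite lee_wpmul2r// lee_fin invr_ge0.
Qed.

Lemma le_hausdorff_gauge A B : A `<=` B -> gauge A <= gauge B.
Proof.
move=> AB; have [->|/set0P A0] := eqVneq A set0.
  by rewrite hausdorff_gauge0 hausdorff_gauge_ge0.
by apply: le_hausdorff_gauge_ediam => //; exact: le_ediam.
Qed.

Lemma hausdorff_preE delta : @hausdorff_pre R n m delta =
  mu_ext (gauge : set (small_sets n delta) -> \bar R).
Proof.
apply/funext => A; rewrite /hausdorff_pre /mu_ext; congr ereal_inf.
by apply/seteqP; split => _ [C [? ?] <-]; exists C.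
Qed.

Lemma hausdorff_pre0 delta : hausdorff_pre m delta (set0 : set 'rV[R]_n) = 0.
Proof. rewrite hausdorff_preE mu_ext0//; [exact: hausdorff_gauge0|exact: hausdorff_gauge_ge0]. Qed.

Lemma hausdorff_pre_ge0 delta A : 0 <= hausdorff_pre m delta A.
Proof. by rewrite hausdorff_preE mu_ext_ge0//; exact: hausdorff_gauge_ge0. Qed.

Lemma le_hausdorff_pre delta : {homo @hausdorff_pre R n m delta : A B / A `<=` B >-> A <= B}.
Proof.
move=> A B AB; rewrite hausdorff_preE.
exact: (@le_mu_ext _ (small_sets n delta)).
Qed.

Lemma hausdorff_pre_sigma_subadditive delta : sigma_subadditive (@hausdorff_pre R n m delta).
Proof.
rewrite hausdorff_preE.
exact: (@mu_ext_sigma_subadditive _ (small_sets n delta) _ _ hausdorff_gauge_ge0).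
Qed.

HB.instance Definition _ delta := isOuterMeasure.Build R 'rV[R]_n
  (@hausdorff_pre R n m delta) (hausdorff_pre0 delta) (hausdorff_pre_ge0 delta)
  (@le_hausdorff_pre delta) (@hausdorff_pre_sigma_subadditive delta).

Lemma hausdorff_pre_anti delta delta' A : (delta <= delta')%R ->
  hausdorff_pre m delta' A <= hausdorff_pre m delta A.
Proof.
move=> dd; apply: ereal_inf_le_tmp => _ [C [AC Cd] <-]; exists C => //; split=> // k.
by rewrite (le_trans (Cd k))// lee_fin.
Qed.

Lemma hausdorff_pre_le delta A : (0 < delta)%R -> hausdorff_pre m delta A <= hausdorff m A.
Proof. by move=> d0; apply: ereal_sup_ubound; exists delta. Qed.

Lemma hausdorff_le A (M : \bar R) :
  (forall delta, (0 < delta)%R -> hausdorff_pre m delta A <= M) -> hausdorff m A <= M.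
Proof. by move=> H; apply: ge_ereal_sup => _ [delta /= d0 <-]; exact: H. Qed.

Lemma hausdorff0 : hausdorff m (set0 : set 'rV[R]_n) = 0.
Proof.
apply/eqP; rewrite eq_le; apply/andP; split.
  by apply: hausdorff_le => d d0; rewrite hausdorff_pre0.
by apply: le_trans (hausdorff_pre_le _ ltr01); rewrite hausdorff_pre0.
Qed.

Lemma hausdorff_ge0 A : 0 <= hausdorff m A.
Proof. by apply: le_trans (hausdorff_pre_le _ ltr01); exact: hausdorff_pre_ge0. Qed.

Lemma le_hausdorff : {homo @hausdorff R n m : A B / A `<=` B >-> A <= B}.
Proof.
move=> A B AB; apply: hausdorff_le => d d0.
by apply: le_trans (hausdorff_pre_le _ d0); exact: le_hausdorff_pre.
Qed.

Lemma hausdorff_sigma_subadditive : sigma_subadditive (@hausdorff R n m).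
Proof.
move=> F; apply: hausdorff_le => d d0.
apply: le_trans (hausdorff_pre_sigma_subadditive _ _) _.
apply: lee_nneseries => [k _ _|k _]; first exact: hausdorff_pre_ge0.
exact: hausdorff_pre_le.
Qed.

HB.instance Definition _ := isOuterMeasure.Build R 'rV[R]_n (@hausdorff R n m)
  hausdorff0 hausdorff_ge0 le_hausdorff hausdorff_sigma_subadditive.

(** A set of diameter less than [r] cannot meet both [A] and [B], so a fine covering of the union
    splits into a covering of each at no extra cost. *)
Lemma hausdorff_metric A B (r : R) : (0 < r)%R ->
  (forall a b, A a -> B b -> (r <= enorm (a - b))%R) ->
  hausdorff m A + hausdorff m B <= hausdorff m (A `|` B).
Proof.
move=> r0 rAB.
have key d1 d2 : (0 < d1)%R -> (0 < d2)%R ->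
    hausdorff_pre m d1 A + hausdorff_pre m d2 B <= hausdorff m (A `|` B).
  move=> d10 d20; pose d := Num.min (Num.min d1 d2) (r / 2)%R.
  have d0 : (0 < d)%R by rewrite !lt_min d10 d20 divr_gt0.
  have dr : (d < r)%R by rewrite gt_min gtr_pMr ?r0// invf_lt1// ltr1n orbT.
  apply: le_trans (hausdorff_pre_le _ d0).
  apply: (@le_trans _ _ (hausdorff_pre m d A + hausdorff_pre m d B)).
    by apply: leeD; apply: hausdorff_pre_anti; rewrite !ge_min lexx ?orbT.
  apply: le_ereal_inf_tmp => _ [C [ABC Cd] <-].
  have hp D : D `<=` A `|` B ->
      hausdorff_pre m d D <= \sum_(k <oo) gauge (C k `&` D).
    move=> DAB; apply: ereal_inf_lbound; exists (fun k => C k `&` D) => //; split.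
      by move=> x Dx; have [k _ Ckx] := ABC _ (DAB _ Dx); exists k.
    by move=> k; apply: le_trans (Cd k); apply: le_ediam; exact: subIsetl.
  apply: (le_trans (leeD (hp _ (@subsetUl _ A B)) (hp _ (@subsetUr _ A B)))).
  rewrite -nneseriesD; try by move=> *; exact: hausdorff_gauge_ge0.
  apply: lee_nneseries => [k _ _|k _]; first by rewrite adde_ge0// hausdorff_gauge_ge0.
  have [->|/set0P[a [Ca Aa]]] := eqVneq (C k `&` A) set0.
    by rewrite hausdorff_gauge0 add0e le_hausdorff_gauge.
  have [->|/set0P[b [Cb Bb]]] := eqVneq (C k `&` B) set0.
    by rewrite hausdorff_gauge0 adde0 le_hausdorff_gauge.
  have := rAB _ _ Aa Bb; rewrite leNgt (le_lt_trans _ dr)//.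
  by rewrite -lee_fin (le_trans (le_ediam_point Ca Cb)).
rewrite {1}/hausdorff; apply: adde_ereal_sup_le; first exact: hausdorff_ge0.
  by exists (hausdorff_pre m 1 A); exists 1%R => //=.
move=> _ [d1 /= d10 <-]; rewrite addeC {1}/hausdorff.
apply: adde_ereal_sup_le; first exact: hausdorff_pre_ge0.
  by exists (hausdorff_pre m 1 B); exists 1%R => //=.
by move=> _ [d2 /= d20 <-]; rewrite addeC; exact: key.
Qed.

End hausdorff_outer.

Lemma hausdorff_lipschitz (R : realType) n n' m (f : 'rV[R]_n -> 'rV[R]_n') (L : R)
    (A : set 'rV[R]_n) : 0 < L ->
  (forall x y, A x -> A y -> enorm (f x - f y) <= L * enorm (x - y)) ->
  (hausdorff m (f @` A) <= (L ^+ m)%:E * hausdorff m A)%E.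
Proof.
move=> L0 fL; apply: hausdorff_le => d d0.
have Ld0 : 0 < d / L by rewrite divr_gt0.
have Lm0 : 0 < L ^+ m by rewrite exprn_gt0.
apply: (@le_trans _ _ ((L ^+ m)%:E * hausdorff_pre m (d / L) A)%E); last first.
  by rewrite lee_wpmul2l ?lee_fin ?(ltW Lm0)// hausdorff_pre_le.
rewrite -lee_pdivrMl//; apply: le_ereal_inf_tmp => _ [C [AC Cd] <-].
rewrite lee_pdivrMl// -nneseriesZl; last by move=> *; exact: hausdorff_gauge_ge0.
(* The covering sets are cut down to [A], where alone [f] is known to be Lipschitz. *)
apply: (@le_trans _ _ (\sum_(k <oo) hausdorff_gauge m (f @` (C k `&` A)))%E).
  apply: ereal_inf_lbound; exists (fun k => f @` (C k `&` A)) => //; split.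
    move=> _ [x Ax <-]; have [k _ Ckx] := AC _ Ax.
    by exists k => //; exists x.
  move=> k; have [->|/set0P CA0] := eqVneq (C k `&` A) set0.
    by rewrite image_set0 ediam0 leNye.
  apply: (@le_trans _ _ (L%:E * ediam (C k `&` A))%E).
    by apply: ediam_image_le => // [|x y [_ Ax] [_ Ay]]; [exact: ltW|exact: fL].
  rewrite -lee_pdivlMl// -EFinM mulrC (le_trans _ (Cd k))// le_ediam//.
apply: lee_nneseries => [k _ _|k _]; first exact: hausdorff_gauge_ge0.
have [->|/set0P CA0] := eqVneq (C k `&` A) set0.
  by rewrite image_set0 hausdorff_gauge0 mule_ge0 ?lee_fin ?(ltW Lm0)// hausdorff_gauge_ge0.
have fCA0 : f @` (C k `&` A) != set0.
  by apply/set0P; have [x CAx] := CA0; exists (f x); exists x.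
apply: (@le_trans _ _ ((L ^+ m)%:E * hausdorff_gauge m (C k `&` A))%E); last first.
  by rewrite lee_wpmul2l ?lee_fin ?(ltW Lm0)// le_hausdorff_gauge.
rewrite /hausdorff_gauge (negbTE fCA0) (negbTE (proj2 (set0P _) CA0)).
rewrite muleCA lee_wpmul2l ?omega_ge0// EFin_expe -expeM.
have fCA_ge0 := ediam_ge0 (proj1 (set0P _) fCA0).
apply: lee_expe; first by rewrite mule_ge0// lee_fin invr_ge0.
rewrite muleA lee_wpmul2r ?lee_fin ?invr_ge0//.
by apply: ediam_image_le => // [|x y [_ Ax] [_ Ay]]; [exact: ltW|exact: fL].
Qed.

(** * Caratheodory's criterion for metric outer measures *)

Section metric_outer_measure.
Context {R : realType} {n : nat}.
Variable mu : {outer_measure set 'rV[R]_n -> \bar R}.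
Hypothesis mu_metric : forall (A B : set 'rV[R]_n) (r : R), (0 < r)%R ->
  (forall a b, A a -> B b -> (r <= enorm (a - b))%R) ->
  (mu A + mu B <= mu (A `|` B))%E.

Section level_set.
Variable d : 'rV[R]_n -> R.
Hypothesis d_lip : forall x y, d x - d y <= enorm (x - y).
Variable X : set 'rV[R]_n.
Hypothesis muX : (mu X < +oo)%E.

Let s (k : nat) : R := k.+1%:R^-1.

Let s_lt j k : (j < k)%N -> s k < s j.
Proof. by move=> jk; rewrite ltf_pV2 ?posrE// ltr_nat. Qed.

Let s_gt0 k : 0 < s k. Proof. by rewrite invr_gt0. Qed.

Let above (a : R) : set 'rV[R]_n := X `&` [set x | a <= d x].
Let ring k : set 'rV[R]_n := X `&` [set x | s k.+1 <= d x < s k].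

Let mu_split (a b : R) (A B : set 'rV[R]_n) : b < a ->
  (forall x, A x -> a <= d x) -> (forall x, B x -> d x <= b) ->
  (mu A + mu B <= mu (A `|` B))%E.
Proof.
move=> ba Aa Bb; apply: (@mu_metric _ _ (a - b)); first by rewrite subr_gt0.
move=> x y /Aa ax /Bb yb; apply: le_trans (d_lip x y); lra.
Qed.

Let U (i N : nat) : set 'rV[R]_n := \big[setU/set0]_(j < N) ring (i + 2 * j)%N.

(** Two rings of the same parity are kept apart by the ring skipped between them, so [mu] is
    superadditive on each parity class; hence both series are bounded by [mu X]. *)
Let mu_rings (i N : nat) :
  (\sum_(0 <= j < N) mu (ring (i + 2 * j)%N) <= mu (U i N))%E.
Proof.
rewrite big_mkord; elim: N => [|[|N] ih].
- by rewrite big_ord0 outer_measure_ge0.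
- by rewrite /U !big_ord_recr !big_ord0/= add0e set0U.
- have -> : U i N.+2 = U i N.+1 `|` ring (i + 2 * N.+1)%N.
    by rewrite /U big_ord_recr.
  rewrite [in leLHS]big_ord_recr/=.
  apply: le_trans (leeD2r _ ih) _.
  apply: (@mu_split (s (i + 2 * N).+1) (s (i + 2 * N.+1)%N)).
  + by apply: s_lt; lia.
  + move=> x; rewrite /U -(bigcup_mkord _ (fun j => ring (i + 2 * j)%N)) =>
      -[j /= jN [_ /= /andP[+ _]]].
    by apply: le_trans; rewrite lef_pV2 ?posrE// ler_nat; lia.
  + by move=> x [_ /= /andP[_ /ltW]].
Qed.

Let mu_rings_lty i : (\sum_(j <oo) mu (ring (i + 2 * j)%N) < +oo)%E.
Proof.
apply: le_lt_trans muX; apply: lime_le.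
  by apply: is_cvg_nneseries => *; exact: outer_measure_ge0.
apply: nearW => N; apply: le_trans (mu_rings i N) _; apply: le_outer_measure.
by rewrite /U -(bigcup_mkord _ (fun j => ring (i + 2 * j)%N)); apply: bigcup_sub => j _; exact: subIsetl.
Qed.

(** The part of [X] where [d] is at least [s (2 * K)] lies at positive distance from the part
    outside [D], so the metric property applies to these two. What is left consists of rings, whose
    measures are summable, so its measure vanishes as K grows. *)
Lemma level_set_caratheodory_le (D := [set x | 0 < d x]) :
  (mu (X `&` D) + mu (X `&` ~` D) <= mu X)%E.
Proof.
pose t i K := (\sum_(K <= j <oo) mu (ring (i + 2 * j)%N))%E.
have t0 i : (t i @ \oo --> 0)%E.
  by apply: nneseries_tail_cvg => // *; exact: outer_measure_ge0.
have tail i K : (mu (\bigcup_(j in ~` `I_K) ring (i + 2 * j)%N) <= t i K)%E.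
  exact: (outer_measure_sigma_subadditive_tail mu).
have bound K : (mu (X `&` D) + mu (X `&` ~` D)
    <= mu X + (t 0%N K + t 1%N K))%E.
  have cov : X `&` D `<=` above (s (2 * K)) `|`
      (\bigcup_(j in ~` `I_K) ring (0 + 2 * j)%N `|`
       \bigcup_(j in ~` `I_K) ring (1 + 2 * j)%N).
    move=> x [Xx /= dx]; have [sd|ds] := leP (s (2 * K)) (d x); first by left.
    have [k sk] : exists k, s k <= d x.
      by have /ltr_add_invr[k] := dx; rewrite add0r => /ltW; exists k.
    (* The ring containing x is found by descending from [k], where [s k <= d x], towards [2 * K],
       where [d x] lies below [s]. *)
    have [k' [sk' dk' Kk']] : exists k', [/\ s k'.+1 <= d x, d x < s k' & (2 * K <= k')%N].
      have kK : (2 * K <= k)%N.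
        by rewrite leqNgt; apply/negP => /s_lt kK; have := lt_trans ds kK; rewrite ltNge sk.
      rewrite -(subnK kK) in sk; elim: (k - 2 * K)%N sk => [|j ih] sk.
        by move: ds; rewrite ltNge sk.
      have [/ih//|dj] := leP (s (j + 2 * K)) (d x).
      by exists (j + 2 * K)%N; rewrite leq_addl.
    right; have rk' : ring k' x by split => //=; rewrite sk' dk'.
    have := odd_double_half k'; rewrite -muln2 mulnC; case: (odd k') => /= e.
      right; exists k'./2; last by rewrite e.
      by rewrite /= => /=; lia.
    left; exists k'./2; last by rewrite e.
    by rewrite /=; lia.
  apply: le_trans (leeD2r _ (le_outer_measure mu _ _ cov)) _.
  apply: le_trans (leeD2r _ (outer_measureU2 _ _ _)) _.
  rewrite addeAC; apply: leeD; last first.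
    by apply: le_trans (outer_measureU2 _ _ _) _; exact: leeD.
  apply: le_trans (@mu_split (s (2 * K)) 0 _ _ _ _ _) _ => //.
  - by move=> x [].
  - by move=> x [_ /= /negP]; rewrite -leNgt.
  - by apply: le_outer_measure => x [] [].
have cv : (mu X + (t 0%N K + t 1%N K) @[K --> \oo] --> mu X + (0 + 0))%E.
  apply: cvgeD; [by rewrite adde0 fin_num_adde_defl|exact: cvg_cst|].
  by apply: cvgeD.
have := cvg_lim _ cv; rewrite !adde0 => <- //.
by apply: lime_ge; [apply/cvg_ex; eexists; exact: cv|exact: nearW].
Qed.

End level_set.

Lemma level_set_caratheodory (d : 'rV[R]_n -> R) :
  (forall x y, d x - d y <= enorm (x - y)) -> mu.-caratheodory [set x | 0 < d x].
Proof.
move=> d_lip; apply: le_caratheodory_measurable => X.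
have [->|] := eqVneq (mu X) +oo%E; first by rewrite leey.
by rewrite -ltey => muX; exact: level_set_caratheodory_le.
Qed.

Lemma borel_caratheodory (A : set (@borel_rV R n)) :
  measurable A -> mu.-caratheodory A.
Proof.
move: A; apply: borel_ind.
  split; [exact: caratheodory_measurable_set0| |exact: caratheodory_measurable_bigcup].
  by move=> A; rewrite setTD; exact: caratheodory_measurable_setC.
move=> U Uo; rewrite (open_bigcup_ball (@rat_point_dense R n) Uo).
apply: caratheodory_measurable_bigcup => i; rewrite bigcup_mkcond.
apply: caratheodory_measurable_bigcup => j; case: ifP => _; last first.
  exact: caratheodory_measurable_set0.
(* A ball of the sup norm is the positivity set of a function that is 1-Lipschitz for the Euclidean
   distance, since the sup norm is the smaller one. *)
rewrite [X in caratheodory_measurable _ X](_ : _ =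
    [set x | 0 < j.+1%:R^-1 - `|rat_point n i - x|]); last first.
  by apply/seteqP; split => x; rewrite -ball_normE/= subr_gt0.
apply: level_set_caratheodory => x y; have := norm_le_enorm (x - y).
have : `|rat_point n i - y| <= `|rat_point n i - x| + `|x - y|.
  by apply: le_trans (ler_normD _ _); rewrite addrA subrK.
move: `|rat_point n i - y| `|rat_point n i - x| `|x - y| => a b c.
move: (enorm _) (j.+1%:R^-1 : R) => e r; lra.
Qed.

End metric_outer_measure.

Lemma finite_outer_measure_subadditive (R : realType) (T : Type) (I : finType)
    (mu : {outer_measure set T -> \bar R}) (F : I -> set T) (A : set T) :
  (forall x, A x -> exists i, F i x) -> (mu A <= \sum_i mu (F i))%E.
Proof.
move=> AF; apply: (@le_trans _ _ (mu (\big[setU/set0]_i F i))).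
  apply: le_outer_measure => x /AF[i Fix].
  by rewrite (bigD1 i)//=; left.
elim/big_rec2 : _ => [|i y B _ ih]; first by rewrite outer_measure0.
by apply: le_trans (outer_measureU2 _ _ _) _; exact: leeD2l.
Qed.

(** * Borel regularity of Hausdorff measure *)

Section hausdorff_regular.
Context {R : realType} {n : nat} (m : nat).
Implicit Types (A C : set 'rV[R]_n).

Lemma closed_enorm_ball (y : 'rV[R]_n) (r : R) : closed [set x | enorm (x - y) <= r].
Proof.
suff fc : continuous (fun x : 'rV[R]_n => enorm (x - y)).
  exact: (closed_comp (fun x _ => fc x) (@closed_le R r)).
apply: (@lipschitz_continuous _ _ _ _ n%:R) => u v.
apply: le_trans (ler_dist_enorm _ _) _.
by rewrite opprB addrA subrK; exact: enorm_le_norm.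
Qed.

(* The double polar of C for the relation |x - y| <= diam C. *)
Lemma closed_same_ediam C (delta : R) : (ediam C <= delta%:E)%E ->
  exists D, [/\ closed D, C `<=` D, (ediam D <= delta%:E)%E &
                (hausdorff_gauge m D <= hausdorff_gauge m C)%E].
Proof.
move=> Cdelta; have [C0|/set0P C0] := eqVneq C set0.
  by exists set0; rewrite C0; split => //; [exact: closed0|rewrite ediam0 leNye].
have /fineK Cfin : ediam C \is a fin_num.
  by rewrite ge0_fin_numE ?ediam_ge0// (le_lt_trans Cdelta)// ltry.
pose r := fine (ediam C).
pose far (B : set 'rV[R]_n) := \bigcap_(y in B) [set x | enorm (x - y) <= r].
have farC : C `<=` far C.
  by move=> x Cx y Cy /=; rewrite -lee_fin Cfin; exact: le_ediam_point.
have Dr : (ediam (far (far C)) <= ediam C)%E.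
  apply: ediam_le => x y Dx Dy; rewrite -Cfin lee_fin.
  by apply: Dx => z Cz; apply: Dy; exact: farC.
have CD : C `<=` far (far C) by move=> x Cx y /(_ _ Cx) /=; rewrite enormBC.
exists (far (far C)); split => //.
- by apply: closed_bigI => y _; exact: closed_enorm_ball.
- exact: le_trans Cdelta.
- by apply: le_hausdorff_gauge_ediam => //; have [x Cx] := C0; exists x; exact: CD.
Qed.

(** Take nearly optimal coverings by closed sets at the scales 1/(j+1). The intersection of their
    unions is Borel, and each covering of [A] covers it as well, at the same cost. *)
Lemma hausdorff_borel_hull A : exists B : set (@borel_rV R n),
  [/\ measurable B, A `<=` B & (hausdorff m B <= hausdorff m A)%E].
Proof.
have [Ay|] := eqVneq (hausdorff m A) +oo%E.
  by exists setT; split => //; rewrite Ay leey.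
rewrite -ltey => Ay; pose s (j : nat) : R := j.+1%:R^-1.
have s0 j : 0 < s j by rewrite invr_gt0.
have /choice[C CP] j : exists C : nat -> set 'rV[R]_n, [/\ forall k, closed (C k),
    A `<=` \bigcup_k C k, forall k, (ediam (C k) <= (s j)%:E)%E &
    (\sum_(k <oo) hausdorff_gauge m (C k) <= hausdorff m A + (s j)%:E)%E].
  have Afin : hausdorff_pre m (s j) A \is a fin_num.
    by rewrite ge0_fin_numE ?hausdorff_pre_ge0// (le_lt_trans _ Ay)// hausdorff_pre_le.
  have [_ [C [AC Cs] <-] Clt] := lb_ereal_inf_adherent (s0 j) Afin.
  have /choice[D DP] k := closed_same_ediam (Cs k).
  exists D; split => [k|x /AC[k _ Ckx]|k|].
  - by have [] := DP k.
  - by exists k => //; have [_ + _ _] := DP k; exact.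
  - by have [] := DP k.
  - apply: (@le_trans _ _ (\sum_(k <oo) hausdorff_gauge m (C k))%E).
      apply: lee_nneseries => [k _ _|k _]; first exact: hausdorff_gauge_ge0.
      by have [] := DP k.
    by apply: le_trans (ltW Clt) _; rewrite leeD2r// hausdorff_pre_le.
exists (\bigcap_j \bigcup_k C j k); split.
- apply: bigcapT_measurable => j; apply: bigcupT_measurable => k.
  by apply: closed_borel; have [] := CP j.
- by move=> x Ax j _; have [_ + _ _] := CP j; exact.
- apply: hausdorff_le => delta delta0; apply/lee_addgt0Pr => e e0.
  have [j [js je]] : exists j, s j <= delta /\ s j <= e.
    have de0 : 0 < Num.min delta e by rewrite lt_min delta0.
    have /ltr_add_invr[j] := de0; rewrite add0r lt_min => /andP[/ltW ? /ltW ?].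
    by exists j.
  apply: le_trans (hausdorff_pre_anti _ _ js) _.
  have [_ _ Cs Csum] := CP j.
  apply: (@le_trans _ _ (hausdorff m A + (s j)%:E)%E); last by rewrite leeD2l// lee_fin.
  apply: le_trans Csum; apply: ereal_inf_lbound; exists (C j) => //; split => //.
  by move=> x /(_ j Logic.I).
Qed.

Lemma hausdorff_borel (A : set (@borel_rV R n)) : measurable A ->
  (@hausdorff R n m).-caratheodory A.
Proof. exact/borel_caratheodory/hausdorff_metric. Qed.

Lemma hausdorff_pre_le_gauge (delta : R) C :
  (ediam C <= delta%:E)%E -> (hausdorff_pre m delta C <= hausdorff_gauge m C)%E.
Proof.
move=> Cd; apply: ereal_inf_lbound.
exists (fun k => if k == 0%N then C else set0).
  split; first by move=> x Cx; exists 0%N.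
  by case=> //= k; rewrite ediam0 leNye.
rewrite nneseries_recl//; last by move=> *; exact: hausdorff_gauge_ge0.
by rewrite eseries0 ?adde0// => -[|k]//= _ _; rewrite hausdorff_gauge0.
Qed.

End hausdorff_regular.

(** * Finiteness of Hausdorff measure on bounded sets *)

Section hausdorff_cube.
Context {R : realType} (m : nat).
Hypothesis omega_lty : (omega R m < +oo)%E.

Let Q : set 'rV[R]_m := [set y | forall i, 0 <= y ord0 i < 1].

(** Cutting the cube into N^m cells of diameter at most m/N costs at most N^m times [omega]
    (m/(2N))^m, which does not depend on N. *)
Lemma hausdorff_unit_cube_lty : (hausdorff m Q < +oo)%E.
Proof.
have omega_fin : omega R m \is a fin_num by rewrite ge0_fin_numE// omega_ge0.
apply: (@le_lt_trans _ _ (omega R m * ((m%:R / 2) ^+ m)%:E)%E); last first.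
  by rewrite ltey_eq fin_numM.
apply: hausdorff_le => delta delta0.
have [k mk] : exists k, m%:R / k.+1%:R <= delta.
  have d0 : 0 < delta / m.+1%:R by rewrite divr_gt0.
  have /ltr_add_invr[k] := d0; rewrite add0r ltr_pdivlMr// => /ltW kd; exists k.
  by apply: le_trans kd; rewrite mulrC ler_wpM2l ?invr_ge0// ler_nat.
pose N := k.+1; have N0 : 0 < N%:R :> R by [].
pose C (f : {ffun 'I_m -> 'I_N}) : set 'rV[R]_m :=
  [set y | forall i, (f i)%:R <= y ord0 i * N%:R < (f i).+1%:R].
have Cdiam f : (ediam (C f) <= (m%:R / N%:R)%:E)%E.
  apply: ediam_le => x y Cx Cy; rewrite lee_fin.
  apply: le_trans (enorm_le_norm _) _; rewrite ler_wpM2l//.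
  rewrite [leLHS]/Num.norm/= mx_normrE; apply/bigmax_leP; split=> [|[i j] _ /=].
    by rewrite invr_ge0.
  rewrite ord1 !mxE -[leRHS]mul1r ler_pdivlMr// -[X in _ * X](gtr0_norm N0) -normrM mulrBl.
  have := Cx j; have := Cy j; rewrite -!natr1 => /andP[? ?] /andP[? ?].
  by rewrite ler_norml; apply/andP; split; lra.
have QC y : Q y -> exists f, C f y.
  move=> Qy.
  have ylt i : (Num.truncn (y ord0 i * N%:R) < N)%N.
    have /andP[y0 y1] := Qy i.
    by rewrite truncn_lt_nat ?mulr_ge0// gtr_pMl.
  exists [ffun i => Ordinal (ylt i)] => i; rewrite ffunE/=.
  by apply: truncn_itv; have /andP[y0 _] := Qy i; rewrite mulr_ge0.
apply: le_trans (finite_outer_measure_subadditive _ QC) _.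
apply: (@le_trans _ _ (\sum_(f : {ffun 'I_m -> 'I_N})
    omega R m * ((m%:R / N%:R / 2) ^+ m)%:E)%E).
  apply: lee_sum => f _; apply: le_trans (hausdorff_pre_le_gauge _ _) _.
    by apply: le_trans (Cdiam f) _; rewrite lee_fin.
  rewrite /hausdorff_gauge; case: ifPn => [_|/set0P Cf0].
    by rewrite mule_ge0 ?omega_ge0// lee_fin exprn_ge0.
  rewrite lee_wpmul2l ?omega_ge0// EFin_expe lee_expe//.
    by rewrite mule_ge0 ?ediam_ge0// lee_fin invr_ge0.
  by rewrite EFinM lee_wpmul2r// lee_fin invr_ge0.
rewrite -(fineK omega_fin) -EFinM sumEFin lee_fin sumr_const card_ffun !card_ord.
rewrite -[leLHS]mulr_natr -mulrA ler_wpM2l ?fine_ge0 ?omega_ge0//.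
by rewrite natrX -exprMn mulrAC divfK// gt_eqF.
Qed.

Lemma hausdorff_lipschitz_ball_lty n (f : 'rV[R]_m -> 'rV[R]_n) (L r : R) : 0 < L ->
  (forall x y, enorm (f x - f y) <= L * enorm (x - y)) ->
  (hausdorff m (f @` [set y | (`|y| <= r)%R]) < +oo)%E.
Proof.
move=> L0 fL; have r0 : 0 < `|r| + 1 by rewrite ltr_pwDr.
(* [h] maps the unit cube onto a half-open cube of half-side [|r| + 1]: positive whatever the sign
   of r, and wide enough for the closed ball of radius r. *)
pose h (y : 'rV[R]_m) := (2 * (`|r| + 1)) *: y - const_mx (`|r| + 1).
have hL x y : enorm (h x - h y) = 2 * (`|r| + 1) * enorm (x - y).
  rewrite /h opprB addrA subrK -scalerBr enormZ gtr0_norm// mulr_gt0.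
have sub : f @` [set y | `|y| <= r] `<=` (f \o h) @` Q.
  move=> _ [y /= yr <-]; pose z := (2 * (`|r| + 1))^-1 *: (y + const_mx (`|r| + 1)).
  exists z; last first.
    by rewrite /= /h /z scalerA divff ?scale1r ?addrK// gt_eqF// mulr_gt0.
  move=> i; rewrite !mxE.
  have : `|y ord0 i| <= `|r| by rewrite (le_trans (coord_le_norm _ _))// (le_trans yr)// ler_norm.
  rewrite ler_norml => /andP[? ?]; rewrite mulrC ltr_pdivrMr ?mulr_gt0// divr_ge0 ?mulr_ge0 ?(ltW r0)//=; lra.
apply: (@le_lt_trans _ _ (hausdorff m ((f \o h) @` Q))); first exact: le_hausdorff.
have L2 : 0 < L * (2 * (`|r| + 1)) by rewrite !mulr_gt0.
apply: (le_lt_trans (@hausdorff_lipschitz _ _ _ m _ _ Q L2 _)).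
  by move=> x y _ _ /=; rewrite (le_trans (fL _ _))// hL mulrA.
have := hausdorff_unit_cube_lty; rewrite -ge0_fin_numE ?hausdorff_ge0// => Qfin.
by rewrite ltey_eq fin_numM.
Qed.

End hausdorff_cube.

(** * Translation invariant measures *)

Definition pushforward_measure d d' (T1 : measurableType d) (T2 : measurableType d')
    (R : realFieldType) (m : {measure set T1 -> \bar R}) (f : T1 -> T2)
    (mf : measurable_fun setT f) : {measure set T2 -> \bar R}.
Proof. by refine (pushforward m f : measure _ _). Defined.

Section locally_finite.
Context {R : realType} {n : nat}.
Variable mu : {measure set (@borel_rV R n) -> \bar R}.
Hypothesis mu_ball : forall r : R, (mu [set x : 'rV[R]_n | (`|x| <= r)%R] < +oo)%E.

(** The vacuous [let] makes the term depend on the proof of local finiteness, so that the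
    sigma-finite structure can be attached to it as a canonical instance. *)
Definition sigma_finite_of : set (@borel_rV R n) -> \bar R :=
  let _ := mu_ball in mu.

Lemma closed_norm_ball_measurable r :
  measurable ([set x : 'rV[R]_n | `|x| <= r] : set (@borel_rV R n)).
Proof.
apply: closed_borel.
exact: (closed_comp (fun x _ => @norm_continuous _ 'rV[R]_n x) (@closed_le R r)).
Qed.

Let sigma_finite_of_sigma_finite : sigma_finite setT sigma_finite_of.
Proof.
exists (fun k => [set x : 'rV[R]_n | `|x| <= k%:R]) => [|k].
  apply/esym; rewrite -subTset => x _.
  exists (Num.truncn `|x|).+1 => //=.
  by have /andP[_ /ltW] := truncn_itv (normr_ge0 x).
split; first exact: closed_norm_ball_measurable.
exact: mu_ball.
Qed.

HB.instance Definition _ := Measure.on sigma_finite_of.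
HB.instance Definition _ := Measure_isSigmaFinite.Build _ _ _ sigma_finite_of
  sigma_finite_of_sigma_finite.

End locally_finite.

Section lebesgue_translation.
Context {R : realType}.
Local Notation leb := (@lebesgue_measure R).

Lemma measurable_addr (a : R) :
  measurable_fun setT ((fun t : R => t + a) : measurableTypeR R -> measurableTypeR R).
Proof. exact: measurable_funD. Qed.

Lemma lebesgue_measure_shift (a : R) (A : set (measurableTypeR R)) : measurable A ->
  leb A = pushforward leb ((fun t => t + a) : measurableTypeR R -> measurableTypeR R) A.
Proof.
have mf := measurable_addr a.
move=> mA; apply: lebesgue_measure_unique => //= _ [[x y]] _ <-.
rewrite /pushforward (_ : _ @^-1` _ = `](x - a), (y - a)]%classic); last first.
  by apply/seteqP; split => t /=; rewrite !in_itv/= ltrBlDr lerBrDr.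
rewrite !lebesgue_measure_itv/= !lte_fin ltrD2r -!EFinD.
by case: ifP => // _; rewrite opprB addrA subrK.
Qed.

Lemma ge0_integral_shift (a : R) (f : R -> \bar R) :
  measurable_fun setT (f : measurableTypeR R -> _) -> (forall t, 0 <= f t)%E ->
  (\int[leb]_t f (t + a)%R = \int[leb]_t f t)%E.
Proof.
move=> mf f0; have ma := measurable_addr a.
transitivity (\int[pushforward leb ((fun t => (t + a)%R) : measurableTypeR R -> measurableTypeR R)]_t f t)%E.
  by rewrite (ge0_integral_pushforward ma).
by apply: eq_measure_integral => //= A mA _; rewrite -lebesgue_measure_shift.
Qed.

End lebesgue_translation.

Section haar.
Context {R : realType} {n : nat}.
Local Notation borel := (@borel_rV R n).

Definition translation_invariant (mu : set borel -> \bar R) :=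
  forall (a : 'rV[R]_n) (A : set borel), measurable A ->
    mu [set x : 'rV[R]_n | A (x + a)] = mu A.

Lemma open_borel_prod (W : set ('rV[R]_n * 'rV[R]_n)) : open W ->
  measurable (W : set (borel * borel)).
Proof.
move=> Wo; have := @open_prod_measurable R _ _ _ _ borel borel id id _ _
  (@rat_point_dense R n) (@rat_point_dense R n) _ _ W Wo.
rewrite (_ : [set _ | _] = W); last by apply/seteqP; split => -[].
by apply => x e; apply: open_borel; exact: ball_open.
Qed.

Lemma continuous_borel_prod (f : 'rV[R]_n * 'rV[R]_n -> 'rV[R]_n) :
  continuous f -> measurable_fun setT (f : borel * borel -> borel).
Proof.
move=> fc; apply: (@measurability _ _ (borel * borel)%type borel _ _ (@open 'rV[R]_n)) => //.
move=> _ [U Uo <-]; rewrite setTI; apply: open_borel_prod.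
by apply: open_comp => // ? _; exact: fc.
Qed.

(* Both sides are the measure of {(x, y) | y in Q, x + y in A}, up to the
   measure preserving substitution (x, y) -> (x - y, y). *)
Lemma translation_invariant_proportional
    (mu nu : {sigma_finite_measure set borel -> \bar R}) (Q A : set borel) :
  translation_invariant mu -> translation_invariant nu ->
  measurable Q -> measurable A -> (forall x : 'rV[R]_n, Q x -> Q (- x)) ->
  (mu A * nu Q = mu Q * nu A)%E.
Proof.
move=> mu_inv nu_inv mQ mA QN.
have mAdd : measurable_fun setT ((fun p => p.1 + p.2) : borel * borel -> borel).
  by apply: continuous_borel_prod; exact: add_continuous.
have mSub : measurable_fun setT ((fun p => p.2 - p.1) : borel * borel -> borel).
  apply: (@continuous_borel_prod (fun p => p.2 - p.1)) => p.
  by apply: cvgB; [exact: cvg_snd|exact: cvg_fst].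
have section_meas (f : borel * borel -> borel) B : measurable_fun setT f ->
    measurable B -> measurable (f @^-1` B).
  by move=> mf mB; rewrite -[X in measurable X]setTI; exact: mf.
pose W : set (borel * borel) := [set p | Q p.2 /\ A (p.1 + p.2)].
have mW : measurable W.
  apply: measurableI; last exact: section_meas mAdd mA.
  exact: (section_meas snd Q).
pose V : set (borel * borel) := [set p | A p.2 /\ Q (p.2 - p.1)].
have mV : measurable V.
  apply: measurableI; last exact: section_meas mSub mQ.
  exact: (section_meas snd A).
have swap (Z : set (borel * borel)) : measurable Z ->
    (\int[mu]_x nu (xsection Z x) = \int[nu]_y mu (ysection Z y))%E.
  move=> mZ; have := indic_fubini_tonelli mu nu mZ.
  by rewrite indic_fubini_tonelli_FE// indic_fubini_tonelli_GE.
have mulE (B C : set borel) : measurable B -> (\int[nu]_(y in B) (mu C) = mu C * nu B)%E.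
  move=> mB; rewrite integral_cst//.
transitivity (\int[nu]_y mu (ysection W y))%E.
  rewrite -mulE// integral_mkcond; apply: eq_integral => y _; rewrite patchE.
  case: ifPn => [/set_mem Qy|/negP Qy].
    rewrite -(mu_inv y)//; congr (mu _); apply/seteqP; split => x.
      by move=> Axy; rewrite /ysection/= inE; split.
    by rewrite /ysection/= inE => -[].
  rewrite (_ : ysection W y = set0) ?measure0//; apply/seteqP; split => x //.
  by rewrite /ysection/= inE => -[/= Qy' _]; apply: Qy; rewrite inE.
rewrite -swap//; transitivity (\int[mu]_x nu (xsection V x))%E.
  apply: eq_integral => x _; rewrite -(nu_inv x (xsection V x)); last exact: measurable_xsection.
  congr (nu _); apply/seteqP; split => y; rewrite /xsection/= !inE/=.
    by move=> [/= Qy Axy]; split => /=; rewrite ?addrK// addrC.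
  by move=> [/= Axy Qy]; rewrite addrK in Qy; split => //=; rewrite addrC.
rewrite swap// -mulE// [RHS]integral_mkcond; apply: eq_integral => y _; rewrite patchE.
case: ifPn => [/set_mem Ay|/negP Ay].
  rewrite -(mu_inv (- y) Q)//; congr (mu _); apply/seteqP; split => x.
    by rewrite /ysection/= inE => -[_ /= /QN]; rewrite opprB.
  by move=> /QN; rewrite opprB => Qxy; rewrite /ysection/= inE; split.
rewrite (_ : ysection V y = set0) ?measure0//; apply/seteqP; split => x //.
by rewrite /ysection/= inE => -[/= Ay' _]; apply: Ay; rewrite inE.
Qed.

End haar.

(** * Volume and linear maps *)

Section abs_det.
Context {R : realFieldType}.

(** Meant for the factor by which a linear map scales volume: for permutation and diagonal matrices
    it is read off from the cube [-1,1]^n, whose image is again a box. Shears do not map the cube to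
    a box; their value is deduced from these axioms. *)
Definition det_like n (d : 'M[R]_n -> R) :=
  [/\ forall S, 0 <= d S,
      forall S T, S \in unitmx -> T \in unitmx -> d (S *m T) = d S * d T,
      forall s : 'S_n, d (perm_mx s) = 1 &
      forall D : 'rV_n, (forall i, D ord0 i != 0) ->
        d (diag_mx D) = \prod_i `|D ord0 i|].

Lemma sqr_eq1 (x : R) : 0 <= x -> x * x = 1 -> x = 1.
Proof.
move=> x0 xx; apply/eqP; rewrite -(@eqrXn2 _ 2)//; first by rewrite expr1n expr2 xx.
Qed.

(* A transvection is conjugate to its inverse through diag(-1, 1, ..., 1). *)
Lemma det_like_transvection n (d : 'M[R]_(1 + n) -> R) :
  det_like d -> (forall v : 'rV_n, d (block_mx 1%:M v 0 1%:M) = 1) /\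
                (forall c : 'cV_n, d (block_mx 1%:M 0 c 1%:M) = 1).
Proof.
move=> [d0 dM dperm ddiag].
have d1 : d 1%:M = 1 by rewrite -perm_mx1 dperm.
pose D : 'M[R]_(1 + n) := block_mx (- 1%:M) 0 0 1%:M.
have uD : D \in unitmx by rewrite unitmxE det_ublock det1 mulr1 -scaleN1r detZ det1 mulr1 unitrX// unitrN1.
have dD : d D = 1.
  rewrite /D (_ : block_mx _ _ _ _ = diag_mx (row_mx (const_mx (-1)) (const_mx 1))).
    rewrite ddiag => [|i].
      apply: big1 => i _; case: (split_ordP i) => j ->.
        by rewrite row_mxEl mxE normrN1.
      by rewrite row_mxEr mxE normr1.
    by case: (split_ordP i) => j ->; rewrite ?row_mxEl ?row_mxEr mxE ?oppr_eq0 oner_eq0.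
  by rewrite diag_mx_row !diag_const_mx raddfN.
have inv_eq1 (N N' : 'M[R]_(1 + n)) : N *m N' = 1%:M -> D *m N *m D = N' -> d N = 1.
  move=> NN' DND; have [uN uN'] := mulmx1_unit NN'.
  apply: sqr_eq1 => //; rewrite -d1 -NN' dM// -DND !dM ?dD ?mul1r ?mulr1//.
  by rewrite unitmx_mul uD.
pose mE := (mul0mx, mulmx0, mul1mx, mulmx1, mulNmx, mulmxN, addr0, add0r, opprK).
split=> [v|c].
  apply: (inv_eq1 _ (block_mx 1%:M (- v) 0 1%:M)); rewrite /D !mulmx_block !mE.
    by rewrite addNr -scalar_mx_block.
  by rewrite ?oppr0.
apply: (inv_eq1 _ (block_mx 1%:M 0 (- c) 1%:M)); rewrite /D !mulmx_block !mE.
  by rewrite subrr -scalar_mx_block.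
by rewrite ?oppr0.
Qed.

(** Gaussian elimination: a column transposition makes the corner entry [a] nonzero, then T is the
    product of a lower transvection, diag(a, 1), diag(1, A) and an upper transvection, with A the
    Schur complement. *)
Lemma det_like_absE n (d : 'M[R]_n -> R) : det_like d ->
  forall T, T \in unitmx -> d T = `|\det T|.
Proof.
elim: n d => [|n ih] d dd T uT.
  have [_ _ dperm _] := dd.
  by rewrite det_mx00 normr1 -(dperm 1%g) perm_mx1; congr d; rewrite [LHS]flatmx0 [RHS]flatmx0.
have [d0 dM dperm ddiag] := dd.
have d1 : d 1%:M = 1 by rewrite -perm_mx1 dperm.
wlog T00 : T uT / T ord0 ord0 != 0 => [wlogT|].
  have [j Tj] : exists j, T ord0 j != 0.
    apply/existsP; apply: contraT; rewrite negb_exists => /forallP T0.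
    move: uT; rewrite unitmxE (expand_det_row _ ord0) big1 ?unitr0// => j _.
    by move: (T0 j); rewrite negbK => /eqP ->; rewrite mul0r.
  have uP : tperm_mx ord0 j \in (@unitmx R n.+1) by exact: unitmx_perm.
  have := wlogT (T *m tperm_mx ord0 j).
  rewrite unitmx_mul uT uP dM// dperm mulr1 det_mulmx det_perm normrM normrX normrN1 expr1n mulr1.
  by apply => //; rewrite -xcolE mxE tpermL.
have [dv dc] := @det_like_transvection n d dd.
have [_ _ _ {}ddiag] : @det_like (1 + n) d := dd.
pose a := T ord0 ord0; pose r := ursubmx (T : 'M[R]_(1 + n)).
pose c := dlsubmx (T : 'M[R]_(1 + n)); pose A := drsubmx (T : 'M[R]_(1 + n)) - a^-1 *: (c *m r).
have TE : T = block_mx 1%:M 0 (a^-1 *: c) 1%:M *m block_mx a%:M 0 0 1%:M *m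
    block_mx 1%:M 0 0 A *m block_mx 1%:M (a^-1 *: r) 0 1%:M :> 'M[R]_(1 + n).
  rewrite !mulmx_block !(mul0mx, mulmx0, mul1mx, mulmx1, addr0, add0r).
  rewrite -[LHS](@submxK _ 1 n 1 n); congr block_mx.
  - by apply/rowP => i; rewrite !ord1 !mxE/= mulr1n /a; congr (T _ _); apply: val_inj.
  - by rewrite mul_scalar_mx scalerA divff// scale1r.
  - by rewrite mul_mx_scalar scalerA divff// scale1r.
  - rewrite mul_mx_scalar scalerA divff// scale1r -scalemxAr.
    by rewrite /A addrC subrK.
have ua : block_mx a%:M 0 0 1%:M \in (@unitmx R (1 + n)).
  by rewrite unitmxE det_ublock det1 mulr1 det_scalar1 unitfE.
have uc : block_mx 1%:M 0 (a^-1 *: c) 1%:M \in (@unitmx R (1 + n)).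
  by rewrite unitmxE det_lblock !det1 mulr1 unitr1.
have ur : block_mx 1%:M (a^-1 *: r) 0 1%:M \in (@unitmx R (1 + n)).
  by rewrite unitmxE det_ublock !det1 mulr1 unitr1.
have detT : \det T = a * \det A.
  have : \det (T : 'M[R]_(1 + n)) = a * \det A.
    rewrite [in LHS]TE !det_mulmx [X in X * _ * _ * _]det_lblock !det_ublock.
    by rewrite !det1 det_scalar1 !mulr1 !mul1r.
  exact.
have uA : A \in unitmx.
  by move: uT; rewrite !unitmxE detT unitrM => /andP[].
have uA' (B : 'M[R]_n) : B \in unitmx -> block_mx 1%:M 0 0 B \in (@unitmx R (1 + n)).
  by rewrite !unitmxE det_ublock det1 mul1r.
have dA : d (block_mx 1%:M 0 0 A : 'M[R]_(1 + n)) = `|\det A|.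
  (* B |-> d(diag(1, B)) inherits the four properties in dimension n, so the induction hypothesis
     evaluates it at the Schur complement. *)
  apply: (ih (fun B => d (block_mx 1%:M 0 0 B : 'M[R]_(1 + n)))) => //; split => [S|S S' uS uS'|s|D D0].
  - exact: d0.
  - have -> : block_mx 1%:M 0 0 (S *m S') =
        block_mx 1%:M 0 0 S *m block_mx 1%:M 0 0 S' :> 'M[R]_(1 + n).
      by rewrite mulmx_block !(mul0mx, mulmx0, mul1mx, mulmx1, addr0, add0r).
    by rewrite dM ?uA'.
  - by have := dperm (lift0_perm s); rewrite -lift0_mx_perm.
  - rewrite (_ : block_mx _ _ _ _ = diag_mx (row_mx (const_mx 1) D)).
      rewrite ddiag => [|i].
        rewrite (@big_split_ord _ _ _ 1 n)/= big_ord1 row_mxEl mxE normr1 mul1r.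
        by apply: eq_bigr => i _; rewrite row_mxEr.
      by case: (split_ordP i) => j ->; rewrite ?row_mxEl ?row_mxEr// mxE oner_eq0.
    by rewrite diag_mx_row diag_const_mx.
have da : d (block_mx a%:M 0 0 1%:M : 'M[R]_(1 + n)) = `|a|.
  rewrite (_ : block_mx _ _ _ _ = diag_mx (row_mx (const_mx a) (const_mx 1))).
    rewrite ddiag => [|i].
      rewrite (@big_split_ord _ _ _ 1 n)/= big_ord1 row_mxEl mxE big1 ?mulr1// => i _.
      by rewrite row_mxEr mxE normr1.
    by case: (split_ordP i) => j ->; rewrite ?row_mxEl ?row_mxEr mxE// oner_eq0.
  by rewrite diag_mx_row !diag_const_mx.
rewrite detT normrM [in LHS]TE !dM ?unitmx_mul ?uA' ?uc ?ua ?ur//.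
by rewrite dc dv da dA mul1r mulr1.
Qed.

End abs_det.

(** * Volume as a translation invariant Borel measure *)

Lemma cons_rV_ord0 (R : realType) n (t : R) (x : 'rV[R]_n) :
  (row_mx (t%:M : 'rV[R]_1) x : 'rV[R]_n.+1) ord0 (@lshift 1 n ord0 : 'I_n.+1) = t.
Proof. by rewrite [LHS]row_mxEl mxE eqxx mulr1n. Qed.

Lemma cons_rV_rshift (R : realType) n (t : R) (x : 'rV[R]_n) (i : 'I_n) :
  (row_mx (t%:M : 'rV[R]_1) x : 'rV[R]_n.+1) ord0 (@rshift 1 n i : 'I_n.+1) = x ord0 i.
Proof. by rewrite [LHS]row_mxEr. Qed.

Section vol_step.
Context {R : realType} {n : nat}.
Variable mu : {measure set (@borel_rV R n) -> \bar R}.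
Hypothesis mu_ball : forall r : R, (mu [set x : 'rV[R]_n | (`|x| <= r)%R] < +oo)%E.
Local Notation leb := (@lebesgue_measure R).

Let cons_rV (p : measurableTypeR R * @borel_rV R n) : @borel_rV R n.+1 :=
  row_mx (p.1%:M : 'rV[R]_1) (p.2 : 'rV[R]_n).

Lemma normr_row_mx_le (t r : R) (x : 'rV[R]_n) :
  (`|row_mx (t%:M : 'rV[R]_1) x| <= r) = (`|t| <= r) && (`|x| <= r).
Proof.
apply/idP/andP => [H|[tr xr]].
  have r0 : 0 <= r by exact: le_trans H.
  split.
    have := coord_le_norm (row_mx (t%:M : 'rV[R]_1) x) (lshift n ord0).
    by rewrite row_mxEl mxE eqxx mulr1n => /le_trans; exact.
  rewrite [leLHS]/Num.norm/= mx_normrE; apply/bigmax_leP; split => // -[i j] _ /=.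
  have := coord_le_norm (row_mx (t%:M : 'rV[R]_1) x) (rshift 1 j).
  by rewrite row_mxEr (ord1 i) => /le_trans; exact.
rewrite [leLHS]/Num.norm/= mx_normrE; apply/bigmax_leP; split => [|[i j] _ /=].
  exact: le_trans tr.
rewrite ord1; case: (split_ordP j) => k ->.
  by rewrite row_mxEl ord1 mxE eqxx mulr1n.
by rewrite row_mxEr (le_trans (coord_le_norm _ _)).
Qed.

Lemma measurable_row_mx : measurable_fun setT cons_rV.
Proof.
apply: (@measurability _ _ _ (@borel_rV R n.+1) _ _ (@open 'rV[R]_n.+1)) => //.
move=> _ [U Uo <-]; rewrite setTI.
pose W : set (R * 'rV[R]_n) := [set p | U (row_mx (p.1%:M : 'rV[R]_1) p.2)].
have := @open_prod_measurable R R 'rV[R]_n _ _ (measurableTypeR R) (@borel_rV R n)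
  id id _ _ (@rat_real_dense R) (@rat_point_dense R n) _ _ W.
apply.
- by move=> x e; apply: open_measurable; exact: ball_open.
- by move=> x e; apply: open_borel; exact: ball_open.
- rewrite openE => -[t x] Wtx.
  have /nbhs_ballP[e /= e0 eU] : nbhs (row_mx (t%:M : 'rV[R]_1) x : 'rV[R]_n.+1) U.
    exact: open_nbhs_nbhs.
  apply/nbhs_ballP; exists e => //= -[s y] [/= ts xy]; apply: eU.
  suff : @ball R 'rV[R]_(1 + n) (row_mx t%:M x) e (row_mx s%:M y) by [].
  split => // i j; case: (split_ordP j) => k ->.
    by rewrite !row_mxEl !ord1 !mxE eqxx !mulr1n.
  by rewrite !row_mxEr; case: xy => _; exact.
Qed.

Let sf : {sigma_finite_measure set (@borel_rV R n) -> \bar R} := sigma_finite_of mu_ball.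
Let mcons := measurable_row_mx.
Let prod_measure : {measure set (measurableTypeR R * @borel_rV R n) -> \bar R} :=
  product_measure1 leb sf.

(** One recursion step of [vol], obtained as a genuine measure: a product measure carried over by
    prefixing a coordinate. *)
Definition vol_next : {measure set (@borel_rV R n.+1) -> \bar R} :=
  pushforward_measure prod_measure mcons.

Lemma vol_nextE (A : set (@borel_rV R n.+1)) : vol_next A =
  (\int[leb]_t mu [set x : 'rV[R]_n | A (row_mx (t%:M : 'rV[R]_1) x)])%E.
Proof.
apply: eq_integral => t _ /=; congr (mu _); apply/seteqP.
by split => x /=; rewrite /xsection/= inE.
Qed.

Lemma measurable_vol_slice (A : set (@borel_rV R n.+1)) : measurable A ->
  measurable_fun setT ((fun t => mu [set x : 'rV[R]_n | A (row_mx (t%:M : 'rV[R]_1) x)])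
    : measurableTypeR R -> \bar R).
Proof.
move=> mA; have mcA : measurable (cons_rV @^-1` A).
  by rewrite -[X in measurable X]setTI; exact: mcons.
apply: eq_measurable_fun (measurable_fun_xsection sf mcA) => t _ /=.
by congr (mu _); apply/seteqP; split => x /=; rewrite /xsection/= inE.
Qed.

Lemma vol_next_ball (r : R) : (vol_next [set x : 'rV[R]_n.+1 | (`|x| <= r)%R] < +oo)%E.
Proof.
pose B : set (@borel_rV R n) := [set x : 'rV[R]_n | `|x| <= r].
have mB : measurable B by exact: closed_norm_ball_measurable.
rewrite /vol_next/= /pushforward (_ : _ @^-1` _ = `[(- r), r]%classic `*` B); last first.
  apply/seteqP; split => -[t x] /=; rewrite /cons_rV/= normr_row_mx_le in_itv/= -ler_norml.
    by move=> /andP.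
  by move=> /andP.
pose J : set (measurableTypeR R) := `[(- r), r]%classic.
rewrite [X in (X < _)%E](_ : _ = (leb J * sf B)%E); last first.
  exact: product_measure1E.
rewrite lte_mul_pinfty//.
- by rewrite /J lebesgue_measure_itv/=; case: ifP.
- exact: mu_ball.
Qed.

Lemma measurable_slice (A : set (@borel_rV R n.+1)) (t : R) : measurable A ->
  measurable ([set x | A (row_mx (t%:M : 'rV[R]_1) x)] : set (@borel_rV R n)).
Proof.
move=> mA; have mcA : measurable (cons_rV @^-1` A).
  by rewrite -[X in measurable X]setTI; exact: mcons.
have := measurable_xsection t mcA; congr measurable; apply/seteqP.
by split => x /=; rewrite /xsection/= inE.
Qed.

End vol_step.
Arguments vol_next {R n mu}.
Arguments vol_next_ball {R n mu}.

Section vol_measure.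
Context {R : realType}.

(** Finiteness on balls is carried through the induction because it makes the factor sigma-finite,
    as the product measure requires. Agreement is claimed on Borel sets, whose slices are Borel. *)
Lemma vol_measure_ex n : exists mu : {measure set (@borel_rV R n) -> \bar R},
  (forall r : R, (mu [set x : 'rV[R]_n | (`|x| <= r)%R] < +oo)%E) /\
  (forall A : set (@borel_rV R n), measurable A -> mu A = vol A).
Proof.
elim: n => [|n [mu [mu_ball muE]]].
  exists (\d_(0 : @borel_rV R 0)); split => [r|A mA].
    by rewrite /= /dirac ltry.
  by rewrite /= /dirac.
exists (vol_next mu_ball); split => [r|A mA]; first exact: vol_next_ball.
rewrite [LHS](vol_nextE mu_ball A); apply: eq_integral => t _.
by apply: muE; exact: measurable_slice.
Qed.

Definition lebesgue_rV n : {measure set (@borel_rV R n) -> \bar R} :=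
  sval (cid (vol_measure_ex n)).

Lemma lebesgue_rV_ball n r : (lebesgue_rV n [set x : 'rV[R]_n | (`|x| <= r)%R] < +oo)%E.
Proof. by rewrite /lebesgue_rV; case: cid => mu []. Qed.

Lemma lebesgue_rVE n (A : set (@borel_rV R n)) : measurable A -> lebesgue_rV n A = vol A.
Proof. by rewrite /lebesgue_rV; case: cid => mu [? H] /=; exact: H. Qed.

Lemma lebesgue_rV_slice n (A : set (@borel_rV R n.+1)) : measurable A ->
  lebesgue_rV n.+1 A = (\int[@lebesgue_measure R]_t
    lebesgue_rV n [set x : 'rV[R]_n | A (row_mx (t%:M : 'rV[R]_1) x)])%E.
Proof.
move=> mA; rewrite lebesgue_rVE//=; apply: eq_integral => t _.
by rewrite lebesgue_rVE//; exact: measurable_slice.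
Qed.

Lemma measurable_comp_continuous m n (f : 'rV[R]_m -> 'rV[R]_n) (A : set (@borel_rV R n)) :
  continuous f -> measurable A -> measurable (f @^-1` A : set (@borel_rV R m)).
Proof.
move=> fc mA; rewrite -[X in measurable X]setTI.
exact: (continuous_borel fc).
Qed.

Lemma addr_continuous n (a : 'rV[R]_n) : continuous (fun x : 'rV[R]_n => x + a).
Proof.
apply: (@lipschitz_continuous _ _ _ _ 1) => x y.
by rewrite mul1r opprD addrACA subrr addr0.
Qed.

Lemma lebesgue_rV_translation n : translation_invariant (lebesgue_rV n).
Proof.
elim: n => [|n ih] a A mA.
  congr (lebesgue_rV _ _); apply/seteqP; split => x /=; rewrite (thinmx0 (x + a)) (thinmx0 x);
  by rewrite ?(thinmx0 a) ?addr0.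
have mAa : measurable ([set x | A (x + a)] : set (@borel_rV R n.+1)).
  exact: (measurable_comp_continuous (@addr_continuous _ a) mA).
pose a0 := (a : 'rV[R]_(1 + n)) ord0 (lshift n ord0).
pose a' := rsubmx (a : 'rV[R]_(1 + n)).
have aE (t : R) (x : 'rV[R]_n) : row_mx (t%:M : 'rV[R]_1) x + a =
    row_mx ((t + a0)%:M : 'rV[R]_1) (x + a') :> 'rV[R]_(1 + n).
  rewrite -[X in _ + X](@hsubmxK _ 1 1 n) add_row_mx; congr row_mx.
  by apply/rowP => i; rewrite !ord1 !mxE eqxx !mulr1n.
rewrite !lebesgue_rV_slice//.
rewrite -(ge0_integral_shift a0 (measurable_vol_slice (@lebesgue_rV_ball n) mA)) => [|t]; last first.
  exact: measure_ge0.
apply: eq_integral => t _; rewrite -(ih a' [set x | A (row_mx (t + a0)%:M x)]); last first.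
  exact: measurable_slice.
by congr (lebesgue_rV _ _); apply/seteqP; split => x /=; rewrite aE.
Qed.


Definition box n (b : 'I_n -> R) : set (@borel_rV R n) :=
  [set x : 'rV[R]_n | forall i, `|x ord0 i| <= b i].

Lemma measurable_box n (b : 'I_n -> R) : measurable (box b).
Proof.
apply: closed_borel; rewrite (_ : box b = \bigcap_(i in setT) [set x | `|x ord0 i| <= b i]); last first.
    by apply/seteqP; split => [x Bx i _|x Bx i]; [exact: Bx|exact: (Bx i Logic.I)].
apply: closed_bigI => i _.
suff fc : continuous (fun x : 'rV[R]_n => `|x ord0 i|).
  exact: (closed_comp (fun x _ => fc x) (@closed_le R (b i))).
apply: (@lipschitz_continuous _ _ _ _ 1) => x y; rewrite mul1r.
by rewrite (le_trans (ler_dist_dist _ _))// (le_trans _ (coord_le_norm _ i))// !mxE.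
Qed.

Lemma lebesgue_rV_box n (b : 'I_n -> R) : (forall i, 0 <= b i) ->
  lebesgue_rV n (box b) = (\prod_i (2 * b i))%:E.
Proof.
elim: n b => [|n ih] b b0; have mB := measurable_box b.
  have B0 : box b 0 by case.
  by rewrite lebesgue_rVE//= big_ord0 indicE mem_set.
pose b' (i : 'I_n) := b (@rshift 1 n i); pose c := b (@lshift 1 n ord0).
have sliceE (t : R) : [set x | box b (row_mx (t%:M : 'rV[R]_1) x)] =
    if t \in `[(- c), c] then box b' else set0.
  rewrite in_itv/= -ler_norml; apply/seteqP; split => x /=.
    move=> Bx; have := Bx (@lshift 1 n ord0); rewrite cons_rV_ord0 => -> i.
    by have := Bx (@rshift 1 n i); rewrite cons_rV_rshift.
  case: ifPn => // tb B'x i; case: (@split_ordP 1 n i) => j ->.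
    by rewrite (ord1 j) cons_rV_ord0.
  by rewrite cons_rV_rshift; exact: B'x.
rewrite lebesgue_rV_slice//.
transitivity (\int[@lebesgue_measure R]_t
    (lebesgue_rV n (box b') * (\1_(`[(- c)%R, c%R]%classic) t)%:E))%E.
  apply: eq_integral => t _; rewrite sliceE indicE; case: ifPn => tb.
    by rewrite mem_set// mule1.
  by rewrite memNset ?mule0 ?measure0//; exact/negP.
rewrite ge0_integralZl//; last first.
  by apply/measurable_EFinP; exact: measurable_indic.
rewrite integral_indic// setIT/= lebesgue_measure_itv/= (ih b')//; last by move=> i; exact: b0.
rewrite (@big_split_ord _ _ _ 1 n)/= big_ord1 EFinM muleC; congr (_ * _)%E.
have bb := b0 (@lshift 1 n ord0).
case: ifPn => [_|]; first by rewrite -EFinD; congr EFin; rewrite opprK mulr_natl mulr2n.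
rewrite lte_fin -leNgt => bN; have c0 : c = 0 by rewrite /c in bN *; lra.
by congr EFin; rewrite -/c c0 mulr0.
Qed.

Lemma omega_lty n : (omega R n < +oo)%E.
Proof.
have mU : measurable (unit_ball R n : set (@borel_rV R n)).
  apply: closed_borel; rewrite (_ : unit_ball R n = [set x | enorm (x - 0) <= 1]).
    exact: closed_enorm_ball.
  by apply/seteqP; split => x; rewrite /unit_ball/= subr0.
rewrite /omega -lebesgue_rVE//; apply: le_lt_trans (lebesgue_rV_ball n 1).
apply: le_measure; rewrite ?inE//; first exact: closed_norm_ball_measurable.
by move=> x; apply: le_trans; exact: norm_le_enorm.
Qed.

End vol_measure.

(** * The determinant as the factor of volumes *)

Section lebesgue_linear.
Context {R : realType} {n : nat}.
Local Notation borel := (@borel_rV R n).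
Local Notation lebn := (@lebesgue_rV R n).

Let Q : set borel := [set x : 'rV[R]_n | `|x| <= 1].

Let mQ : measurable Q. Proof. exact: closed_norm_ball_measurable. Qed.

Let Q_box : Q = box (fun=> 1).
Proof.
apply/seteqP; split => x /= Qx.
  by move=> i; apply: le_trans Qx; exact: coord_le_norm.
rewrite /Q/= [leLHS]/Num.norm/= mx_normrE; apply/bigmax_leP; split => // -[i j] _ /=.
by rewrite (ord1 i); exact: Qx.
Qed.

Let lebnQ : lebn Q = (2 ^+ n)%:E.
Proof.
rewrite Q_box lebesgue_rV_box// prodr_const card_ord; congr EFin.
by rewrite mulr1.
Qed.

Lemma measurable_lin_image (T : 'M[R]_n) (A : set borel) : T \in unitmx ->
  measurable A -> measurable (lin_image T A : set borel).
Proof.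
move=> uT mA; rewrite lin_imageE//.
exact: (measurable_comp_continuous (@mulmx_continuous _ _ _ (invmx T)) mA).
Qed.

Let lin_ball_lty (T : 'M[R]_n) (r : R) : T \in unitmx ->
  (lebn (lin_image T [set x : 'rV[R]_n | (`|x| <= r)%R]) < +oo)%E.
Proof.
move=> uT; have [C C0 CT] := enorm_mulmx_bound T.
apply: le_lt_trans (@lebesgue_rV_ball R n (C * (n%:R * r))).
apply: le_measure; rewrite ?inE.
- by apply: measurable_lin_image => //; exact: closed_norm_ball_measurable.
- exact: closed_norm_ball_measurable.
- move=> _ [x /= xr <-]; apply: le_trans (norm_le_enorm _) _.
  apply: le_trans (CT _) _; rewrite ler_wpM2l ?(ltW C0)//.
  by apply: le_trans (enorm_le_norm _) _; rewrite ler_wpM2l.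
Qed.

(** The volume of the image under T is translation invariant in its argument, since T turns a shift
    by a into a shift by [a *m T]; hence it is proportional to volume. *)
Let lin_proportional (T : 'M[R]_n) (A : set borel) : T \in unitmx -> measurable A ->
  (lebn (lin_image T A) * lebn Q = lebn (lin_image T Q) * lebn A)%E.
Proof.
move=> uT mA.
pose nu := pushforward_measure lebn (continuous_borel (@mulmx_continuous _ _ _ (invmx T))).
have nuE (B : set borel) : nu B = lebn (lin_image T B) by rewrite lin_imageE.
have nu_ball r : (nu [set x : 'rV[R]_n | (`|x| <= r)%R] < +oo)%E.
  by rewrite nuE; exact: lin_ball_lty.
rewrite -!nuE; apply: (translation_invariant_proportional
    (mu := sigma_finite_of nu_ball) (nu := sigma_finite_of (@lebesgue_rV_ball R n))) => //.
- move=> a B mB; rewrite /sigma_finite_of/= -/(nu _) -/(nu B) !nuE.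
  rewrite -[RHS](lebesgue_rV_translation (a *m T)); last exact: measurable_lin_image.
  congr (lebn _); rewrite !lin_imageE//; apply/seteqP.
  by split => x /=; rewrite mulmxDl mulmxK.
- exact: lebesgue_rV_translation.
- by move=> x; rewrite /Q/= normrN.
Qed.

Let ratio (T : 'M[R]_n) : R := fine (lebn (lin_image T Q)) / 2 ^+ n.

Let pow2_neq0 : 2 ^+ n != 0 :> R. Proof. by rewrite expf_neq0. Qed.

Let lebn_lin_Q (T : 'M[R]_n) : T \in unitmx ->
  lebn (lin_image T Q) = (ratio T * 2 ^+ n)%:E.
Proof.
move=> uT; rewrite /ratio divfK// fineK// ge0_fin_numE; first exact: lin_ball_lty.
exact: measure_ge0.
Qed.

Let lebn_lin_ratio (T : 'M[R]_n) (A : set borel) : T \in unitmx -> measurable A ->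
  lebn (lin_image T A) = ((ratio T)%:E * lebn A)%E.
Proof.
move=> uT mA; have := lin_proportional uT mA; rewrite lebnQ lebn_lin_Q// EFinM.
rewrite muleAC => /(congr1 (fun x => x * (2 ^+ n)^-1%:E)%E).
by rewrite -!muleA -!EFinM divff// !mule1.
Qed.

Let ratio_det_like : det_like ratio.
Proof.
split => [S|S T uS uT|s|D D0].
- by rewrite /ratio divr_ge0 ?exprn_ge0// fine_ge0// measure_ge0.
(* Multiplicativity is the proportionality for T, applied to the image of the cube under S. *)
- rewrite {1}/ratio -lin_image_comp lebn_lin_ratio//; last exact: measurable_lin_image.
  by rewrite lebn_lin_Q// -EFinM/= mulrA mulfK// mulrC.
- rewrite /ratio (_ : lin_image _ Q = Q) ?lebnQ ?divff//.
  rewrite Q_box; apply/seteqP; split => [_ [x Qx <-] i|y Qy].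
    by rewrite -[s]invgK -col_permE mxE.
  exists (y *m perm_mx s^-1); last by rewrite -mulmxA -perm_mxM mulVg perm_mx1 mulmx1.
  by move=> i; rewrite -col_permE mxE.
- rewrite /ratio (_ : lin_image _ Q = box (fun i => `|D ord0 i|)).
    by rewrite lebesgue_rV_box//= big_split/= prodr_const card_ord mulrAC divff// mul1r.
  rewrite Q_box; apply/seteqP; split => [_ [x Qx <-] i|y Qy].
    by rewrite mul_mx_diag mxE normrM ler_piMl//; exact: Qx.
  exists (\row_i (y ord0 i / D ord0 i)).
    move=> i; rewrite mxE normrM normfV ler_pdivrMr ?normr_gt0 ?D0// mul1r.
    exact: Qy.
  by apply/rowP => i; rewrite mul_mx_diag !mxE divfK.
Qed.

Lemma lebesgue_rV_linear (T : 'M[R]_n) (A : set borel) : T \in unitmx -> measurable A ->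
  lebn (lin_image T A) = (`|\det T|%:E * lebn A)%E.
Proof. by move=> uT mA; rewrite lebn_lin_ratio// (det_like_absE ratio_det_like). Qed.

Lemma vol_SL (T : 'M[R]_n) (A : set borel) : SL T -> measurable A ->
  vol (lin_image T A) = vol A.
Proof.
move=> detT mA; have uT := SL_unitmx detT.
by rewrite -!lebesgue_rVE// ?lebesgue_rV_linear ?detT ?mul1e//; exact: measurable_lin_image.
Qed.

End lebesgue_linear.

(** * Hausdorff measure of almost flat sets *)

Section hausdorff_restriction.
Context {R : realType} {n : nat} (m : nat) (V : set 'rV[R]_n).
Local Notation borel := (@borel_rV R n).
Local Open Scope ereal_scope.

(** [V] is arbitrary: additivity over Borel sets A comes from their Caratheodory measurability. It
    is used for a hyperplane and for the set of points with a unique normal. *)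
Definition hausdorff_on (A : set borel) : \bar R := hausdorff m (V `&` A).

Let hausdorff_on0 : hausdorff_on set0 = 0.
Proof. by rewrite /hausdorff_on setI0 hausdorff0. Qed.

Let hausdorff_on_ge0 A : 0 <= hausdorff_on A.
Proof. exact: hausdorff_ge0. Qed.

Let hausdorff_on_sigma : semi_sigma_additive hausdorff_on.
Proof.
move=> F mF tF mUF.
have -> : hausdorff_on (\bigcup_k F k) = \sum_(k <oo) hausdorff_on (F k).
  apply/eqP; rewrite eq_le; apply/andP; split.
    by rewrite /hausdorff_on setI_bigcupr; exact: hausdorff_sigma_subadditive.
  have := caratheodory_lime_le (fun k => hausdorff_borel m (mF k)) tF (V `&` \bigcup_k F k).
  rewrite -[in X in _ + hausdorff m X]setIA setICr setI0 hausdorff0 adde0.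
  apply: le_trans; apply: lee_nneseries => [k _ _|k _]; first exact: hausdorff_on_ge0.
  apply: le_hausdorff => x [Vx Fx]; split => //; split => //.
  by exists k.
by apply/cvg_closeP; split; [exact: is_cvg_nneseries|rewrite closeE].
Qed.

HB.instance Definition _ := isMeasure.Build _ _ _ hausdorff_on
  hausdorff_on0 hausdorff_on_ge0 hausdorff_on_sigma.

End hausdorff_restriction.

Section hausdorff_isometry.
Context {R : realType}.

Lemma hausdorff_le1 n n' m (f : 'rV[R]_n -> 'rV[R]_n') (A : set 'rV[R]_n) :
  (forall x y, A x -> A y -> enorm (f x - f y) <= enorm (x - y)) ->
  (hausdorff m (f @` A) <= hausdorff m A)%E.
Proof.
move=> fL; rewrite -[leRHS]mul1e -(expr1n R m).
by apply: hausdorff_lipschitz => // x y Ax Ay; rewrite mul1r; exact: fL.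
Qed.

(** The hypothesis makes g injective on [A] with an L-Lipschitz inverse, to which
    [hausdorff_lipschitz] applies. *)
Lemma hausdorff_expanding n n' m (g : 'rV[R]_n -> 'rV[R]_n') (L : R) (A : set 'rV[R]_n) :
  0 < L -> (forall x y, A x -> A y -> enorm (x - y) <= L * enorm (g x - g y)) ->
  (hausdorff m A <= (L ^+ m)%:E * hausdorff m (g @` A))%E.
Proof.
move=> L0 gL; pose f z := xget 0 (A `&` [set x | g x = z]).
have fP z : (g @` A) z -> A (f z) /\ g (f z) = z.
  by move=> [x Ax <-]; rewrite /f; case: xgetP => [y _ []//|/(_ x)]; case.
apply: (@le_trans _ _ (hausdorff m (f @` (g @` A)))).
  apply: le_hausdorff => x Ax; exists (g x); first by exists x.
  have [Af gf] := fP (g x) (ex_intro2 _ _ x Ax erefl).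
  have := gL _ _ Af Ax; rewrite gf subrr enorm0 mulr0 => fx0.
  apply/eqP; rewrite -subr_eq0; apply/eqP/enorm_eq0/eqP.
  by rewrite eq_le fx0 enorm_ge0.
apply: hausdorff_lipschitz => // z z' /fP[Az gz] /fP[Az' gz'].
by rewrite -{2}gz -{2}gz'; exact: gL.
Qed.

Lemma dot_orthogonal n (O : 'M[R]_n) (x y : 'rV[R]_n) : O *m O^T = 1%:M ->
  dot (x *m O) (y *m O) = dot x y.
Proof. by move=> OO; rewrite dot_mulmx -mulmxA OO mulmx1. Qed.

Lemma enorm_orthogonal n (O : 'M[R]_n) (x : 'rV[R]_n) : O *m O^T = 1%:M ->
  enorm (x *m O) = enorm x.
Proof. by move=> OO; rewrite /enorm dot_orthogonal. Qed.

Lemma hausdorff_orthogonal_le n m (O : 'M[R]_n) (A : set 'rV[R]_n) : O *m O^T = 1%:M ->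
  (hausdorff m (lin_image O A) <= hausdorff m A)%E.
Proof.
by move=> OO; apply: hausdorff_le1 => x y _ _; rewrite -mulmxBl enorm_orthogonal.
Qed.

End hausdorff_isometry.

(** * Linear maps inside a coordinate hyperplane *)

Section coordinate_hyperplane.
Context {R : realType} (m : nat).
Local Notation borel := (@borel_rV R m).

Definition iota_rV (y : 'rV[R]_m) : 'rV[R]_m.+1 := row_mx (0 : 'rV[R]_1) y.

Definition tail_rV (x : 'rV[R]_m.+1) : 'rV[R]_m := @rsubmx R 1 1 m x.

Lemma iota_rVK y : tail_rV (iota_rV y) = y.
Proof. exact: row_mxKr. Qed.

Lemma iota_rV_ord0 y : iota_rV y ord0 (@lshift 1 m ord0) = 0.
Proof. by rewrite [LHS]row_mxEl mxE. Qed.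

Lemma iota_rV_rshift y (i : 'I_m) : iota_rV y ord0 (@rshift 1 m i) = y ord0 i.
Proof. by rewrite [LHS]row_mxEr. Qed.

Lemma iota_rVB x y : iota_rV (x - y) = iota_rV x - iota_rV y.
Proof.
have subE (u v : 'rV[R]_m.+1) i : (u - v) ord0 i = u ord0 i - v ord0 i by rewrite !mxE.
apply/rowP => i; rewrite subE; case: (@split_ordP 1 m i) => j ->.
  by rewrite (ord1 j) !iota_rV_ord0 subr0.
by rewrite !iota_rV_rshift !mxE.
Qed.

Lemma enorm_iota_rV y : enorm (iota_rV y) = enorm y.
Proof.
rewrite /enorm /dot (@big_split_ord _ _ _ 1 m)/= big_ord1 iota_rV_ord0 mul0r add0r.
by congr Num.sqrt; apply: eq_bigr => i _; rewrite !iota_rV_rshift.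
Qed.

Let flat : set 'rV[R]_m.+1 := range iota_rV.

Lemma tail_rV_continuous : continuous tail_rV.
Proof.
apply: (@lipschitz_continuous _ _ _ _ 1) => x y; rewrite mul1r.
rewrite [leLHS]/Num.norm/= mx_normrE; apply/bigmax_leP; split => // -[i j] _ /=.
apply: le_trans (coord_le_norm (x - y) (@rshift 1 m j)).
by rewrite (ord1 i) /tail_rV !mxE.
Qed.

(** H^m on the hyperplane of vanishing first coordinate, read in R^m. It is finite on balls and
    translation invariant, hence comparable with Lebesgue measure. *)
Let mu : {measure set borel -> \bar R} :=
  pushforward_measure (@hausdorff_on R m.+1 m flat) (continuous_borel tail_rV_continuous).

Let muE (A : set borel) : mu A = hausdorff m (iota_rV @` A).
Proof.
rewrite /mu/= /pushforward /hausdorff_on; congr hausdorff; apply/seteqP; split.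
  by move=> _ [[y _ <-]] /=; rewrite iota_rVK => Ay; exists y.
by move=> _ [y Ay <-]; split => /=; [exists y|rewrite iota_rVK].
Qed.

Let mu_ball (r : R) : (mu [set x : 'rV[R]_m | (`|x| <= r)%R] < +oo)%E.
Proof.
rewrite muE; apply: (hausdorff_lipschitz_ball_lty (@omega_lty R m) _ ltr01) => x y.
by rewrite -iota_rVB enorm_iota_rV mul1r.
Qed.

Let mu_translation : translation_invariant mu.
Proof.
have le_mu (a : 'rV[R]_m) (A : set borel) : (mu [set x : 'rV[R]_m | A (x + a)%R] <= mu A)%E.
  rewrite !muE; rewrite (_ : iota_rV @` [set x | A (x + a)] =
      (fun z => z - iota_rV a) @` (iota_rV @` A)).
    apply: hausdorff_le1 => x y _ _.
    by rewrite opprB addrA subrK.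
  apply/seteqP; split => [_ [x Axa <-]|_ [_ [x Ax <-] <-]].
    exists (iota_rV (x + a)); first by exists (x + a).
    by rewrite -iota_rVB addrK.
  by exists (x - a); rewrite ?iota_rVB//= subrK.
move=> a A mA; apply/eqP; rewrite eq_le le_mu/=.
rewrite [leLHS](_ : _ = mu [set x : 'rV[R]_m | [set z | A (z + a)] (x + - a)]).
  exact: le_mu.
by congr (mu _); apply/seteqP; split => x /=; rewrite subrK.
Qed.

(** Proportionality transfers the factor from volume to H^m: the constant [mu Q] enters both sides
    alike, and only the volume 2^m of [Q] has to be cancelled. *)
Let hausdorff_iota_borel (S : 'M[R]_m) (A : set borel) : S \in unitmx -> measurable A ->
  hausdorff m (iota_rV @` (lin_image S A)) = (`|\det S|%:E * hausdorff m (iota_rV @` A))%E.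
Proof.
move=> uS mA; pose Q := box (fun _ : 'I_m => 1 : R).
have mQ : measurable Q := measurable_box _.
have prop (B : set borel) : measurable B ->
    (mu B * lebesgue_rV m Q = mu Q * lebesgue_rV m B)%E.
  move=> mB; apply: (translation_invariant_proportional
    (mu := sigma_finite_of mu_ball) (nu := sigma_finite_of (@lebesgue_rV_ball R m))) => //.
    exact: lebesgue_rV_translation.
  by move=> x Qx i; rewrite mxE normrN; exact: Qx.
have lebQ : lebesgue_rV m Q = (2 ^+ m)%:E.
  by rewrite lebesgue_rV_box// prodr_const card_ord mulr1.
have : (mu (lin_image S A) * (2 ^+ m)%:E = `|\det S|%:E * mu A * (2 ^+ m)%:E)%E.
  rewrite -lebQ prop; last exact: measurable_lin_image.
  by rewrite lebesgue_rV_linear// -muleA prop// muleCA.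
move=> /(congr1 (fun x => x * (2 ^+ m)^-1%:E)%E).
by rewrite -!muleA -!EFinM divff ?expf_neq0// !mule1 !muE.
Qed.

(** An arbitrary set is replaced by a Borel hull, which turns the equality for Borel sets into an
    upper bound. *)
Lemma hausdorff_iota_linear_le (S : 'M[R]_m) (A : set 'rV[R]_m) : S \in unitmx ->
  (hausdorff m (iota_rV @` (lin_image S A)) <= `|\det S|%:E * hausdorff m (iota_rV @` A))%E.
Proof.
move=> uS; have [B [mB AB HB]] := hausdorff_borel_hull m (iota_rV @` A).
pose B' : set borel := [set y | B (iota_rV y)].
have iota_cont : continuous iota_rV.
  apply: (@lipschitz_continuous _ _ _ _ m%:R) => x y; rewrite -iota_rVB.
  apply: le_trans (norm_le_enorm _) _; rewrite enorm_iota_rV; exact: enorm_le_norm.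
have mB' : measurable B' by exact: (measurable_comp_continuous iota_cont mB).
apply: (@le_trans _ _ (hausdorff m (iota_rV @` (lin_image S B')))).
  apply: le_hausdorff; apply: image_subset; apply: image_subset => y Ay.
  by apply: AB; exists y.
rewrite hausdorff_iota_borel// lee_wpmul2l//.
apply: le_trans HB; apply: le_hausdorff => _ [y /= ? <-] //.
Qed.

End coordinate_hyperplane.
Arguments iota_rV {R m}.
Arguments tail_rV {R m}.

(** * Images of hyperplanes and of almost flat sets *)

Section hyperplane.
Context {R : realType} (m : nat).
Local Notation rV := 'rV[R]_m.+1.

Definition e0 : rV := delta_mx ord0 ord0.

Lemma dot_e0 (x : rV) : dot x e0 = x ord0 ord0.
Proof.
rewrite /dot (bigD1 ord0)//= big1 ?addr0 ?mxE ?eqxx ?mulr1// => i i0.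
by rewrite !mxE/= (negbTE i0) mulr0.
Qed.

(* Householder reflection exchanging e0 and u. *)
Lemma reflection_ex (u : rV) : enorm u = 1 ->
  exists O : 'M[R]_m.+1, [/\ O^T = O, O *m O = 1%:M & e0 *m O = u].
Proof.
move=> u1; have uu : dot u u = 1 by rewrite -enorm_sqr u1 expr1n.
have ee : dot e0 e0 = 1 by rewrite dot_e0 mxE !eqxx.
have [ue|ue] := eqVneq (e0 - u) 0.
  exists 1%:M; rewrite trmx1 mulmx1; split => //.
  by rewrite mulmx1; apply/eqP; rewrite -subr_eq0 ue.
pose w := e0 - u; pose q := dot w w.
have q0 : q != 0 by rewrite /q -enorm_sqr expf_neq0// gt_eqF// enorm_gt0.
have qE : q = 2 * dot e0 w.
  by rewrite /q /w dotBl !dotBr ee uu (dotC u); ring.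
pose W := w^T *m w.
have wwE : w *m w^T = q%:M.
  by apply/rowP => i; rewrite ord1 [in RHS]mxE eqxx mulr1n -dot_mxE.
have WT : W^T = W by rewrite /W trmx_mul trmxK.
have WW : W *m W = q *: W.
  by rewrite /W mulmxA -(mulmxA w^T) wwE mul_mx_scalar -scalemxAl.
exists (1%:M - (2 / q) *: W); split.
- by rewrite linearB/= trmx1 linearZ/= WT.
- set a := 2 / q; have aaq : a * (a * q) = a + a.
    by rewrite /a divfK//; ring.
  rewrite mulmxBr mulmx1 mulmxBl mul1mx -scalemxAl -scalemxAr WW !scalerA -mulrA aaq.
  by rewrite scalerDl opprB addrK subrK.
- rewrite mulmxBr mulmx1 -scalemxAr /W mulmxA.
  have -> : e0 *m w^T = (dot e0 w)%:M.
    by apply/rowP => i; rewrite ord1 [in RHS]mxE eqxx mulr1n -dot_mxE.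
  by rewrite mul_scalar_mx scalerA mulrAC -qE divff// scale1r /w opprB addrC subrK.
Qed.

(** The inverse transpose is the cofactor matrix divided by the determinant. For T in SL the result
    is normal to the image of the hyperplane orthogonal to u, and its length is the area factor
    between the two hyperplanes. *)
Definition cofactor_dir (T : 'M[R]_m.+1) (u : rV) : rV := u *m invmx T^T.

Lemma dot_cofactor_dir T (x u : rV) : T \in unitmx ->
  dot (x *m T) (cofactor_dir T u) = dot x u.
Proof.
by move=> uT; rewrite dot_mulmx /cofactor_dir mulmxKV// unitmx_tr.
Qed.

Lemma cofactor_dir_neq0 T u : T \in unitmx -> u != 0 -> cofactor_dir T u != 0.
Proof.
move=> uT; apply: contra => /eqP ct0.
rewrite -(mulmxKV (_ : T^T \in unitmx) u) ?unitmx_tr// -/(cofactor_dir T u).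
by rewrite ct0 mul0mx.
Qed.

(** Reflections exchanging [e0] with u and with the unit normal v of the image turn T into a block
    triangular M with corner entry 1/w. As |det M| = 1, the block [S] that acts on the hyperplane
    has |det S| = w. *)
Lemma hausdorff_hyperplane (T : 'M[R]_m.+1) (u : rV) (A : set rV) :
  SL T -> enorm u = 1 -> (forall x, A x -> dot x u = 0) ->
  (hausdorff m (lin_image T A) <= (enorm (cofactor_dir T u))%:E * hausdorff m A)%E.
Proof.
move=> detT u1 Au; have uT := SL_unitmx detT.
have u0 : u != 0.
  by apply/eqP => u_0; move: u1; rewrite u_0 enorm0 => /eqP; rewrite eq_sym oner_eq0.
pose w := enorm (cofactor_dir T u).
have w0 : 0 < w by rewrite enorm_gt0// cofactor_dir_neq0.
pose v := w^-1 *: cofactor_dir T u.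
have v1 : enorm v = 1 by rewrite enormZ gtr0_norm ?invr_gt0// mulVf// gt_eqF.
have [U1 [symU1 sqrU1 eO1]] := reflection_ex u1.
have [U2 [symU2 sqrU2 eO2]] := reflection_ex v1.
have [M MD] : exists M, M = U1 *m T *m U2 by exists (U1 *m T *m U2).
pose S : 'M[R]_m := @drsubmx R 1 m 1 m M.
(* This is the relation <xT, v> = <x, u> / w, seen in the reflected coordinates. *)
have Mcol0 : M *m e0^T = w^-1 *: e0^T.
  have O2e : U2 *m e0^T = v^T by rewrite -eO2 trmx_mul symU2.
  have O1u : U1 *m u^T = e0^T.
    by rewrite -eO1 trmx_mul symU1 mulmxA sqrU1 mul1mx.
  have Tv : T *m v^T = w^-1 *: u^T.
    rewrite /v linearZ/= -scalemxAr /cofactor_dir trmx_mul trmx_inv trmxK.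
    by rewrite mulmxA mulmxV// mul1mx.
  by rewrite MD -mulmxA O2e -mulmxA Tv -scalemxAr O1u.
have e0T (k : 'I_m.+1) : (e0^T : 'cV[R]_m.+1) k ord0 = (k == ord0)%:R by rewrite !mxE.
have Mcol i : M i ord0 = w^-1 * (i == ord0)%:R.
  transitivity ((M *m e0^T) i ord0); last by rewrite Mcol0 mxE e0T.
  rewrite [RHS]mxE (bigD1 ord0)//= big1 ?addr0; first by rewrite e0T eqxx mulr1.
  by move=> j j0; rewrite e0T (negbTE j0) mulr0.
have ME : M = block_mx (w^-1)%:M (@ursubmx R 1 m 1 m M) 0 S :> 'M[R]_(1 + m).
  rewrite -[LHS](@submxK R 1 m 1 m); congr block_mx; apply/matrixP => i j; rewrite !ord1 !mxE/=.
    rewrite (_ : lshift m ord0 = ord0); last exact: val_inj.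
    by rewrite Mcol eqxx mulr1 mulr1n.
  rewrite (_ : lshift m ord0 = ord0); last exact: val_inj.
  by rewrite Mcol/= mulr0.
have detS : `|\det S| = w.
  have detO O : O *m O = 1%:M -> `|\det O| = 1 :> R.
    move=> /(congr1 (fun X => `|\det X|)); rewrite det_mulmx det1 normrM normr1.
    exact: sqr_eq1.
  have : `|\det (M : 'M[R]_(1 + m))| = 1.
    by rewrite MD !det_mulmx !normrM (detO _ _ sqrU1) (detO _ _ sqrU2) detT !mulr1.
  rewrite ME det_ublock det_scalar1 normrM gtr0_norm ?invr_gt0// => /(congr1 ( *%R w)).
  by rewrite mulrA divff ?gt_eqF// mul1r mulr1.
have uS : S \in unitmx by rewrite unitmxE unitfE -normr_gt0 detS.
have OT O : O^T = O -> O *m O = 1%:M -> O *m O^T = 1%:M :> 'M[R]_m.+1 by move=> ->.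
pose A' : set 'rV[R]_m := tail_rV @` lin_image U1 A.
have AO1 : lin_image U1 A = iota_rV @` A'.
  have iota_tail z : lin_image U1 A z -> iota_rV (tail_rV z) = z.
    move=> [x Ax <-]; apply/rowP => i; case: (@split_ordP 1 m i) => j ->; last first.
      by rewrite iota_rV_rshift [LHS]mxE.
    rewrite (ord1 j) iota_rV_ord0.
    rewrite (_ : lshift m ord0 = ord0); last exact: val_inj.
    have ue : u *m U1 = e0 by rewrite -eO1 -mulmxA sqrU1 mulmx1.
    by rewrite -dot_e0 -ue dot_orthogonal ?Au//; exact: OT.
  by apply/seteqP; split => [z Az|_ [_ [z Az <-] <-]]; rewrite ?iota_tail//;
    exists (tail_rV z); rewrite ?iota_tail//; exists z.
have MA : lin_image (T *m U2) A = iota_rV @` (lin_image S A').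
  have iM y : iota_rV y *m M = iota_rV (y *m S).
    have : row_mx 0 y *m block_mx (w^-1)%:M (@ursubmx R 1 m 1 m M) 0 S =
        row_mx 0 (y *m S) :> 'rV[R]_(1 + m).
      by rewrite mul_row_block !mul0mx !mulmx0 !add0r.
    by rewrite -ME.
  have -> : T *m U2 = U1 *m M by rewrite MD !mulmxA sqrU1 mul1mx.
  rewrite -lin_image_comp AO1; apply/seteqP.
  split => [_ [_ [y Ay <-] <-]|_ [_ [y Ay <-] <-]].
    by exists (y *m S); [exists y|rewrite -iM].
  by exists (iota_rV y); [exists y|rewrite iM].
apply: (@le_trans _ _ (hausdorff m (lin_image (T *m U2) A))).
  rewrite (_ : lin_image T A = lin_image U2 (lin_image (T *m U2) A)).
    exact/hausdorff_orthogonal_le/OT.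
  by rewrite lin_image_comp -mulmxA sqrU2 mulmx1.
rewrite MA; apply: (le_trans (hausdorff_iota_linear_le _ uS)).
rewrite detS lee_wpmul2l ?lee_fin ?enorm_ge0// -AO1.
exact/hausdorff_orthogonal_le/OT.
Qed.

(* If the chords of E are almost orthogonal to u, the projection of E along u is
   almost isometric, before and after applying T. *)
Lemma hausdorff_linear_almost_flat (T : 'M[R]_m.+1) : SL T ->
  exists2 C : R, 0 < C & forall (u : rV) (delta : R) (E : set rV),
    enorm u = 1 -> 0 <= delta -> delta * C < 1 ->
    (forall x y, E x -> E y -> `|dot (x - y) u| <= delta * enorm (x - y)) ->
  (hausdorff m (lin_image T E) <=
   (((1 - delta * C)^-1 ^+ m) * enorm (cofactor_dir T u))%:E * hausdorff m E)%E.
Proof.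
move=> detT; have uT := SL_unitmx detT.
have [C1 C10 TC1] := enorm_mulmx_bound T.
have [C2 C20 TC2] := enorm_mulmx_bound (invmx T).
exists (C1 * C2) => [|u delta E u1 delta0 dC Eflat]; first by rewrite mulr_gt0.
pose P (x : rV) := x - dot x u *: u.
have PB x y : P x - P y = P (x - y).
  by rewrite /P dotBl scalerBl !opprD addrACA.
have Pu x : dot (P x) u = 0.
  by rewrite /P dotBl dotZl -enorm_sqr u1 expr1n mulr1 subrr.
have P1 x : enorm (P x) <= enorm x.
  rewrite -(@ler_pXn2r _ 2)// ?nnegrE ?enorm_ge0// !enorm_sqr.
  rewrite {2}/P dotBr dotZr Pu mulr0 subr0 /P dotBl dotZl dotC.
  by rewrite lerBlDr lerDl (dotC u) -expr2 sqr_ge0.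
(* On the image side the projection is oblique, along [u *m T], so that it corresponds to [P] under
   T. The error |<x - y, u>| |uT| is at most delta C1 |x - y|, and [C2] bounds |x - y| by the length
   of the image chord. *)
pose g (y : rV) := P (y *m invmx T) *m T.
have L0 : 0 < (1 - delta * (C1 * C2))^-1 by rewrite invr_gt0 subr_gt0.
apply: (le_trans (@hausdorff_expanding _ _ _ m g _ (lin_image T E) L0 _)).
  move=> _ _ [x Ex <-] [y Ey <-].
  rewrite ler_pdivlMl ?subr_gt0// /g !mulmxK// -!mulmxBl PB.
  rewrite mulrBl mul1r lerBlDr.
  rewrite {1}(_ : (x - y) *m T = P (x - y) *m T + dot (x - y) u *: (u *m T)); last first.
    by rewrite scalemxAl -mulmxDl subrK.
  apply: (le_trans (ler_enormD _ _)); rewrite lerD2l enormZ.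
  apply: (@le_trans _ _ ((delta * enorm (x - y)) * C1)).
    apply: ler_pM; rewrite ?enorm_ge0//; first exact: Eflat.
    by apply: le_trans (TC1 _) _; rewrite u1 mulr1.
  rewrite mulrAC -!mulrA ler_wpM2l// ler_wpM2l ?(ltW C10)//.
  by apply: le_trans (TC2 _); rewrite mulmxK.
rewrite EFinM -muleA lee_wpmul2l ?lee_fin ?exprn_ge0 ?(ltW L0)//.
rewrite (_ : g @` lin_image T E = lin_image T (P @` E)); last first.
  apply/seteqP; split => [_ [_ [x Ex <-] <-]|_ [_ [x Ex <-] <-]].
    by rewrite /g mulmxK//; exists (P x) => //; exists x.
  by exists (x *m T); [exists x|rewrite /g mulmxK].
apply: (le_trans (hausdorff_hyperplane detT u1 _)); first by move=> _ [x Ex <-].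
rewrite lee_wpmul2l ?lee_fin ?enorm_ge0//; apply: hausdorff_le1 => x y _ _.
by rewrite PB.
Qed.

End hyperplane.

(** * The surface area measure *)

Section gauss_map.
Context {R : realType} {n : nat}.
Local Notation borel := (@borel_rV R n).
Variable K : set 'rV[R]_n.
Hypothesis K_compact : compact K.

Lemma dot_continuous2 : continuous (fun p : 'rV[R]_n * 'rV[R]_n => dot p.1 p.2).
Proof.
apply: (@continuous_big R _ _ _ _ (@add_continuous R)) => i _ p.
apply: (@cvgM _ _ (nbhs p) _ (fun p => p.1 ord0 i) (fun p => p.2 ord0 i)).
  by apply: (@continuous_comp _ _ _ fst (fun x : 'rV[R]_n => x ord0 i));
    [exact: cvg_fst|exact: coord_continuous].
by apply: (@continuous_comp _ _ _ snd (fun x : 'rV[R]_n => x ord0 i));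
  [exact: cvg_snd|exact: coord_continuous].
Qed.

Lemma closed_sphere : closed (sphere R n).
Proof.
exact: (closed_comp (fun x _ => @enorm_continuous R n x) (@closed_eq R 1)).
Qed.

Lemma compact_sphere : compact (sphere R n).
Proof.
apply: bounded_closed_compact closed_sphere.
exists 1; split => // M M1 u /= u1; apply: le_trans (norm_le_enorm u) _.
by rewrite u1 ltW.
Qed.

(** These points are the projection of a closed part of the compact product of [K] and the
    sphere. *)
Lemma closed_normal_points (F : set 'rV[R]_n) : closed F ->
  closed [set x | exists2 u, F u & outer_normal K x u].
Proof.
move=> F_closed.
pose C := [set p : 'rV[R]_n * 'rV[R]_n | F p.2] `&`
  \bigcap_(y in K) [set p | 0 <= dot p.1 p.2 - dot p.2 y].
have C_closed : closed C.
  apply: closedI; first by apply: closed_comp F_closed => p _; exact: cvg_snd.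
  apply: closed_bigI => y _.
  suff fc : continuous (fun p : 'rV[R]_n * 'rV[R]_n => dot p.1 p.2 - dot p.2 y).
    exact: (closed_comp (fun p _ => fc p) (@closed_ge R 0)).
  move=> p; apply: cvgB; first exact: dot_continuous2.
  by apply: (@continuous_comp _ _ _ snd (fun x => dot x y));
    [exact: cvg_snd|exact: dot_continuous].
have : compact ((K `*` sphere R n) `&` C).
  apply: compact_closedI C_closed; exact: compact_setX K_compact compact_sphere.
move=> /(continuous_compact (f := fst)) img.
rewrite (_ : [set x | _] = fst @` ((K `*` sphere R n) `&` C)).
  apply: compact_closed; first exact: norm_hausdorff.
  by apply: img; apply: continuous_subspaceT => p; exact: cvg_fst.
apply/seteqP; split => [x [u Fu [Kx Su xu]]|_ [[x u] [[/= Kx Su] [/= Fu H]] <-]].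
  exists (x, u) => //; split; first by split.
  by split => // y Ky /=; rewrite subr_ge0 dotC; exact: xu.
by exists u => //; split => // y /H /=; rewrite subr_ge0 dotC.
Qed.

Let reg := gauss_preimage K setT.

Lemma gauss_preimageE (A : set 'rV[R]_n) :
  gauss_preimage K A = reg `&` [set x | exists2 u, A u & outer_normal K x u].
Proof.
apply/seteqP; split => [x [u Au ux]|x [[u _ ux] [v Av /ux vu]]].
  by split; [exists u|exists u => //; exact/ux].
by exists u => //; rewrite -vu.
Qed.

Lemma gauss_preimage_setC (A : set 'rV[R]_n) :
  gauss_preimage K (~` A) = reg `\` gauss_preimage K A.
Proof.
apply/seteqP; split => [x [u Au ux]|x [[u _ ux] Ax]].
  split; first by exists u.
  move=> [v Av vx]; apply: Au.
  have /ux <- // : outer_normal K x v by exact/vx.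
by exists u => // Au; apply: Ax; exists u.
Qed.

Lemma gauss_preimage_bigcup (I : Type) (D : set I) (F : I -> set 'rV[R]_n) :
  gauss_preimage K (\bigcup_(i in D) F i) = \bigcup_(i in D) gauss_preimage K (F i).
Proof.
apply/seteqP; split => [x [u [i Di Fiu] ux]|x [i Di [u Fiu ux]]].
  by exists i => //; exists u.
by exists u => //; exists i.
Qed.

(* As Borel sets are Caratheodory measurable, H is additive on the traces of
   Borel sets on the set reg, measurable or not. *)
Lemma gauss_preimage_borel (A : set borel) : measurable A ->
  exists2 X : set borel, measurable X & gauss_preimage K A = reg `&` X.
Proof.
have Pclosed (F : set 'rV[R]_n) : closed F ->
    exists2 X : set borel, measurable X & gauss_preimage K F = reg `&` X.
  move=> Fc; exists [set x | exists2 u, F u & outer_normal K x u]; last exact: gauss_preimageE.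
  by apply: closed_borel; exact: closed_normal_points.
have PC (F : set 'rV[R]_n) : (exists2 X : set borel, measurable X & gauss_preimage K F = reg `&` X) ->
    exists2 X : set borel, measurable X & gauss_preimage K (~` F) = reg `&` X.
  move=> [X mX FX]; exists (~` X); first exact: measurableC.
  by rewrite gauss_preimage_setC FX setDE setCI setIUr setICr set0U.
move: A; apply: borel_ind => [|U Uo]; last first.
  by rewrite -(setCK U); apply: PC; apply: Pclosed; exact: open_closedC.
split => [|A|F PF].
- by exists set0 => //; rewrite gauss_preimageE; congr (_ `&` _); apply/seteqP; split => x // [].
- by rewrite setTD => /PC.
- have /choice[X XP] k : exists X : set borel, measurable X /\ gauss_preimage K (F k) = reg `&` X.
    by have [X mX FX] := PF k; exists X.
  exists (\bigcup_k X k); first by apply: bigcupT_measurable => k; have [] := XP k.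
  rewrite gauss_preimage_bigcup setI_bigcupr; apply: eq_bigcupr => k _.
  by have [] := XP k.
Qed.

Local Open Scope ereal_scope.

Let surface_area0 : surface_area K set0 = 0.
Proof.
rewrite /surface_area (_ : gauss_preimage K set0 = set0) ?hausdorff0//.
by apply/seteqP; split => x // [].
Qed.

Let surface_area_ge0 A : 0 <= surface_area K A.
Proof. exact: hausdorff_ge0. Qed.

Let surface_area_sigma : semi_sigma_additive (surface_area K).
Proof.
move=> F mF tF mUF.
have /choice[X XP] k : exists X : set borel, measurable X /\ gauss_preimage K (F k) = reg `&` X.
  by have [X mX FX] := gauss_preimage_borel (mF k); exists X.
(* The Borel sets [X k] are known to be disjoint only on [reg], where the normal is unique. [seqDU]
   makes them disjoint everywhere without changing their traces on [reg]. *)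
have mX k : measurable (seqDU X k).
  by apply: measurableD; [have [] := XP k|apply: bigsetU_measurable => j _; have [] := XP j].
have FX k : gauss_preimage K (F k) = reg `&` seqDU X k.
  have [_ FXk] := XP k; rewrite FXk; apply/seteqP; split => x [rx Xx]; split => //; last first.
    by case: Xx.
  split=> //; rewrite -bigcup_mkord => -[j /= jk Xjx].
  have [u Fku ux] : gauss_preimage K (F k) x by rewrite FXk.
  have [v Fjv vx] : gauss_preimage K (F j) x by have [_ ->] := XP j.
  have uv : u = v by apply/vx/ux.
  move/trivIsetP : tF => /(_ j k Logic.I Logic.I); rewrite neq_ltn jk => /(_ erefl).
  by move=> /seteqP[+ _] => /(_ u); apply; split => //; rewrite uv.
have surfE k : surface_area K (F k) = hausdorff_on n.-1 reg (seqDU X k).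
  by rewrite /surface_area FX.
rewrite (_ : surface_area K (\bigcup_k F k) = hausdorff_on n.-1 reg (\bigcup_k seqDU X k)); last first.
  rewrite /surface_area /hausdorff_on gauss_preimage_bigcup setI_bigcupr.
  by congr hausdorff; apply: eq_bigcupr => k _; exact: FX.
under eq_fun do under eq_bigr do rewrite surfE.
apply: measure_semi_sigma_additive;
  [exact: mX|exact: trivIset_seqDU|exact: bigcupT_measurable].
Qed.

HB.instance Definition _ := isMeasure.Build _ _ _ (surface_area K)
  surface_area0 surface_area_ge0 surface_area_sigma.

End gauss_map.

Definition surface_measure (R : realType) n (K : set 'rV[R]_n) (K_compact : compact K) :
  {measure set (@borel_rV R n) -> \bar R}.
Proof. by refine (surface_area K : measure _ _). Defined.

(** * Normals and Gauss preimages of linear images *)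

Section normal_map.
Context {R : realType} {m : nat}.
Local Notation rV := 'rV[R]_m.+1.
Local Notation borel := (@borel_rV R m.+1).
Implicit Types (T : 'M[R]_m.+1) (u v x : rV) (K : set rV).

Definition normal_map T u : rV := (enorm (cofactor_dir T u))^-1 *: cofactor_dir T u.

Lemma sphere_neq0 u : sphere R m.+1 u -> u != 0.
Proof.
by move=> u1; apply/eqP => u0; move: u1; rewrite u0 /sphere/= enorm0 => /eqP;
  rewrite eq_sym oner_eq0.
Qed.

Lemma cofactor_dir_gt0 T u : T \in unitmx -> sphere R m.+1 u -> 0 < enorm (cofactor_dir T u).
Proof. by move=> uT Su; rewrite enorm_gt0// cofactor_dir_neq0// sphere_neq0. Qed.

Lemma normal_map_sphere T u : T \in unitmx -> sphere R m.+1 u ->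
  sphere R m.+1 (normal_map T u).
Proof.
move=> uT Su; have w0 := cofactor_dir_gt0 uT Su.
by rewrite /sphere/= /normal_map enormZ gtr0_norm ?invr_gt0// mulVf// gt_eqF.
Qed.

Lemma cofactor_dirV T u : T \in unitmx ->
  cofactor_dir (invmx T) (cofactor_dir T u) = u.
Proof. by move=> uT; rewrite /cofactor_dir trmx_inv invmxK mulmxKV// unitmx_tr. Qed.

Lemma normal_mapK T u : T \in unitmx -> sphere R m.+1 u ->
  normal_map (invmx T) (normal_map T u) = u.
Proof.
move=> uT Su; have w0 := cofactor_dir_gt0 uT Su.
rewrite {1}/normal_map; have -> : cofactor_dir (invmx T) (normal_map T u) =
    (enorm (cofactor_dir T u))^-1 *: u.
  by rewrite /cofactor_dir /normal_map -scalemxAl -/(cofactor_dir _ _) cofactor_dirV.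
rewrite enormZ gtr0_norm ?invr_gt0// Su mulr1 invrK scalerA divff ?scale1r//.
by rewrite gt_eqF.
Qed.

Lemma outer_normal_lin K T x u : T \in unitmx -> outer_normal K x u ->
  outer_normal (lin_image T K) (x *m T) (normal_map T u).
Proof.
move=> uT [Kx Su xu]; split; [by exists x|exact: normal_map_sphere|].
move=> _ [y Ky <-]; rewrite /normal_map !dotZr !dot_cofactor_dir//.
by rewrite ler_wpM2l ?invr_ge0 ?enorm_ge0//; exact: xu.
Qed.

Lemma outer_normal_linV K T x v : T \in unitmx ->
  outer_normal (lin_image T K) (x *m T) v -> outer_normal K x (normal_map (invmx T) v).
Proof.
move=> uT xv; have uT' : invmx T \in unitmx by rewrite unitmx_inv.
have := outer_normal_lin uT' xv.
by rewrite lin_image_comp mulmxV// lin_image1 mulmxK.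
Qed.

(** Uniqueness of the normal passes from xT back to x because [normal_map T] takes normals forward
    and its inverse takes them back. *)
Lemma gauss_preimage_lin K T (B : set rV) : T \in unitmx ->
  gauss_preimage (lin_image T K) B `<=`
  lin_image T (gauss_preimage K (sphere R m.+1 `&` normal_map T @^-1` B)).
Proof.
move=> uT z [v Bv zv]; have uT' : invmx T \in unitmx by rewrite unitmx_inv.
have [[x Kx xz] Sv _] : outer_normal (lin_image T K) z v by exact/zv.
exists x => //; rewrite -xz in zv.
have vN : normal_map T (normal_map (invmx T) v) = v.
  by have := normal_mapK uT' Sv; rewrite invmxK.
exists (normal_map (invmx T) v) => [|u].
  by split; [exact: normal_map_sphere|rewrite /preimage/= vN].
split => [xu|->]; last by apply: outer_normal_linV => //; exact/zv.
have [_ Su _] := xu.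
by have /zv <- := outer_normal_lin uT xu; rewrite normal_mapK.
Qed.

(** If u is normal at x, then <x - y, u> >= 0 for y in [K], so -<x - y, u0> is at most <x - y, u -
    u0>. Exchanging x and y bounds the other sign. *)
Lemma gauss_preimage_flat K (A : set rV) u0 (delta : R) :
  (forall u, A u -> enorm (u - u0) <= delta) ->
  forall x y, gauss_preimage K A x -> gauss_preimage K A y ->
    `|dot (x - y) u0| <= delta * enorm (x - y).
Proof.
move=> Adelta.
suff H x y : gauss_preimage K A x -> gauss_preimage K A y ->
    - dot (x - y) u0 <= delta * enorm (x - y).
  move=> x y Ax Ay; rewrite ler_norml lerNl H//=.
  by rewrite -[dot _ _]opprK -dotNl opprB enormBC; exact: H.
move=> [u Au xu] [v _ yv].
have [Ky _ _] : outer_normal K y v by exact/yv.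
have [_ _ /(_ _ Ky) yx] : outer_normal K x u by exact/xu.
apply: (@le_trans _ _ (dot (x - y) (u - u0))).
  by rewrite dotBr lerDr dotBl subr_ge0.
apply: le_trans (dot_le_enorm _ _) _; rewrite mulrC ler_wpM2r ?enorm_ge0//.
exact: Adelta.
Qed.

End normal_map.

(** * Transport of the surface area measure *)

Section measure_transport.
Context {R : realType} {m : nat}.
Local Notation rV := 'rV[R]_m.+1.
Local Notation borel := (@borel_rV R m.+1).
Local Notation S := (sphere R m.+1).
Variables (T : 'M[R]_m.+1) (K : set rV).
Hypotheses (detT : SL T) (K_compact : compact K).

Let uT : T \in unitmx := SL_unitmx detT.
Let w (u : rV) : R := enorm (cofactor_dir T u).

Lemma measurable_continuous_fun (f : rV -> R) : continuous f ->
  measurable_fun setT (f : borel -> R).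
Proof.
move=> fc; apply: (measurability _ (RGenOInfty.measurableE R)) => //.
move=> _ [_ [a ->] <-]; rewrite setTI; apply: open_borel.
apply: open_comp; last exact: interval_open.
by move=> x _; exact: fc.
Qed.

Lemma cofactor_norm_continuous : continuous (fun u : rV => enorm (cofactor_dir T u)).
Proof.
move=> u; apply: (@continuous_comp _ _ _ (cofactor_dir T) (@enorm R m.+1)).
  exact: mulmx_continuous.
exact: enorm_continuous.
Qed.

Let mS : measurable (S : set borel).
Proof. by apply: closed_borel; exact: closed_sphere. Qed.

Let mw : measurable_fun setT ((EFin \o w) : borel -> \bar R).
Proof.
apply/measurable_EFinP; apply: measurable_continuous_fun.
exact: cofactor_norm_continuous.
Qed.

Lemma measurable_normal_preimage (B : set borel) : measurable B ->
  measurable (S `&` normal_map T @^-1` B : set borel).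
Proof.
move: B; apply: borel_ind => [|U Uo].
  split=> [|A mA|F mF].
  - by rewrite preimage_set0 setI0.
  - rewrite setTD (_ : _ `&` _ = S `\` (S `&` normal_map T @^-1` A)).
      exact: measurableD.
    by rewrite setDIr setDv set0U.
  - by rewrite preimage_bigcup setI_bigcupr; exact: bigcupT_measurable.
rewrite (_ : _ `&` _ = S `&` (normal_map T @^-1` U)°).
  by apply: measurableI => //; apply: open_borel; exact: open_interior.
apply/seteqP; split => u [Su Uu]; split => //; last exact: interior_subset.
have cw : {for u, continuous (normal_map T)}.
  have cV : (enorm (cofactor_dir T v))^-1 @[v --> u] --> (enorm (cofactor_dir T u))^-1.
    have w0 : enorm (cofactor_dir T u) != 0 by rewrite gt_eqF// cofactor_dir_gt0.
    exact: (cvgV w0 (@cofactor_norm_continuous u)).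
  exact: (cvgZ cV (@mulmx_continuous _ _ _ (invmx T^T) u)).
by apply: cw; exact: open_nbhs_nbhs.
Qed.

Lemma surface_area_small (k : R) : 1 < k -> exists2 delta : R, 0 < delta &
  forall (A : set borel) (u0 : rV), measurable A -> A `<=` S -> S u0 ->
    (forall u, A u -> enorm (u - u0) <= delta) ->
  (hausdorff m (lin_image T (gauss_preimage K A)) <=
     k%:E * \int[surface_area K]_(u in A) (w u)%:E)%E.
Proof.
move=> k1; have [C C0 flat] := hausdorff_linear_almost_flat detT.
have [C1 C10 TC1] := enorm_mulmx_bound (invmx T^T).
have [C2 C20 TC2] := enorm_mulmx_bound T^T.
have w_lip (u v : rV) : w u <= w v + C1 * enorm (u - v).
  rewrite -lerBlDl; apply: le_trans (TC1 _); rewrite mulmxBl.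
  by apply: le_trans (ler_dist_enorm _ _); rewrite ler_norm.
have w_lb (u : rV) : S u -> 1 <= C2 * w u.
  by move=> <-; apply: le_trans (TC2 _); rewrite /cofactor_dir mulmxKV// unitmx_tr.
(* The first factor is the loss due to the lack of flatness. The second bounds w(u0)/w(u) on the
   piece, by w(u0) <= w(u) + C1 d and 1 <= C2 w(u). *)
pose f (d : R) := (1 - d * C)^-1 ^+ m * (1 + C1 * C2 * d).
have [delta [delta0 dC fk]] : exists d : R, [/\ 0 < d, d * C < 1 & f d <= k].
  (* The allowance k is shared among m + 1 factors: [d] is chosen so that 1/(1 - d C) and 1 + C1 C2
     d are both at most t. *)
  have [t t1 tk] : exists2 t : R, 1 < t & t ^+ m.+1 <= k.
    have /(cvgr_lt (1 ^+ m.+1))/(_ k) := @exprn_continuous R m.+1 1.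
    rewrite expr1n => /(_ k1) /nbhs_ballP[e /= e0 ek].
    exists (1 + e / 2); first by rewrite ltrDl divr_gt0.
    apply/ltW/ek; rewrite -ball_normE/= opprD addrA subrr sub0r normrN.
    by rewrite gtr0_norm ?divr_gt0// gtr_pMr// invf_lt1// ltr1n.
  have t0 : 0 < t by exact: lt_trans t1.
  have tV : t^-1 < 1 by rewrite invf_lt1.
  pose d := Num.min ((1 - t^-1) / C) ((t - 1) / (C1 * C2)).
  have CC0 : 0 < C1 * C2 by rewrite mulr_gt0.
  have d0 : 0 < d by rewrite lt_min !divr_gt0// subr_gt0.
  have dC : d * C <= 1 - t^-1 by rewrite -ler_pdivlMr// ge_min lexx.
  have dCC : C1 * C2 * d <= t - 1 by rewrite mulrC -ler_pdivlMr// ge_min lexx orbT.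
  exists d; split => //; first by rewrite (le_lt_trans dC)// ltrBlDr ltrDl invr_gt0.
  have tVd : t^-1 <= 1 - d * C by lra.
  apply: le_trans tk; rewrite /f exprSr; apply: ler_pM.
  - by rewrite exprn_ge0// invr_ge0 (le_trans _ tVd)// invr_ge0 ltW.
  - by rewrite addr_ge0// ltW// mulr_gt0.
  - rewrite lerXn2r ?nnegrE ?(ltW t0)//; first by rewrite invr_ge0 (le_trans _ tVd)// invr_ge0 ltW.
    by rewrite -[leRHS]invrK lef_pV2// posrE ?invr_gt0// (lt_le_trans _ tVd)// invr_gt0.
  - by rewrite -lerBrDl.
exists delta => // A u0 mA AS Su0 Adelta.
apply: (le_trans (flat u0 delta _ Su0 (ltW delta0) dC (gauss_preimage_flat Adelta))).
have f0 : 0 <= (1 - delta * C)^-1 ^+ m by rewrite exprn_ge0// invr_ge0 subr_ge0 ltW.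
have p0 : 0 < 1 + C1 * C2 * delta by rewrite ltr_wpDr// !mulr_ge0// ltW.
have w0 : 0 <= w u0 / (1 + C1 * C2 * delta) by rewrite divr_ge0 ?enorm_ge0// ltW.
have wA (u : rV) : A u -> w u0 / (1 + C1 * C2 * delta) <= w u.
  move=> Au; rewrite ler_pdivrMr// mulrDr mulr1.
  apply: le_trans (w_lip u0 u) _; rewrite lerD2l.
  apply: (@le_trans _ _ (C1 * delta)); first by rewrite ler_wpM2l ?(ltW C10)// enormBC Adelta.
  rewrite -!mulrA [leRHS]mulrCA ler_wpM2l ?(ltW C10)// mulrCA mulrA.
  by rewrite -[leLHS]mul1r ler_wpM2r ?(ltW delta0)// w_lb//; exact: AS.
apply: (@le_trans _ _ ((f delta)%:E * ((w u0 / (1 + C1 * C2 * delta))%:E * surface_area K A))%E).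
  have -> : (1 - delta * C)^-1 ^+ m * w u0 = f delta * (w u0 / (1 + C1 * C2 * delta)).
    by rewrite /f -mulrA [X in _ = _ * X]mulrCA divff ?gt_eqF// mulr1.
  by rewrite muleA -EFinM.
apply: lee_pmul => //.
- by rewrite lee_fin /f mulr_ge0// ltW.
- by rewrite mule_ge0 ?lee_fin// hausdorff_ge0.
apply: (@le_trans _ _ (\int[surface_measure K_compact]_(u in A)
    (cst (w u0 / (1 + C1 * C2 * delta))%:E u))%E); first by rewrite integral_cst.
apply: (@ge0_le_integral _ _ _ (surface_measure K_compact)).
- exact: mA.
- by move=> u _; rewrite lee_fin.
- exact: measurable_cst.
- exact: measurable_funTS mw.
- by move=> u Au; rewrite lee_fin; exact: wA.
Qed.


Let SK : {measure set borel -> \bar R} := surface_measure K_compact.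

Lemma surface_area_lin_le (B : set borel) : measurable B ->
  (surface_area (lin_image T K) B <=
   \int[surface_area K]_(u in S `&` normal_map T @^-1` B) (w u)%:E)%E.
Proof.
move=> mB; pose N := S `&` normal_map T @^-1` B.
have mN : measurable (N : set borel) by exact: measurable_normal_preimage.
(* It suffices to reach the bound up to every factor [r^-1] greater than 1, which absorbs the loss
   on small pieces. *)
apply/lee_mul01Pr => [|r /andP[r0 r1]]; first exact: hausdorff_ge0.
have rV1 : 1 < r^-1 by rewrite invf_gt1.
rewrite -lee_pdivlMl//.
have [delta delta0 small] := surface_area_small rV1.
(* With radius [delta / 2], any point of a piece is within [delta] of all the others and can serve
   as [u0]. *)
pose D k : set borel := N `&` [set u | enorm (u - rat_point m.+1 k) <= delta / 2].
have mD k : measurable (D k).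
  by apply: measurableI => //; apply: closed_borel; exact: closed_enorm_ball.
pose A := seqDU D.
have mA k : measurable (A k).
  by apply: measurableD => //; apply: bigsetU_measurable => j _; exact: mD.
have AD k : A k `<=` D k by move=> u [].
have NA : N = \bigcup_k A k.
  rewrite /A -seqDU_bigcup_eq; apply/seteqP; split => [u Nu|u [k _ [Nu _]]//].
  (* Rational points are dense for the sup norm; the division by the dimension makes up for the
     passage to the Euclidean norm. *)
  have e0 : 0 < delta / 2 / m.+1%:R by rewrite !divr_gt0.
  have [k ku] := rat_point_dense u e0; exists k => //; split => //=.
  apply: le_trans (enorm_le_norm _) _; rewrite -ler_pdivlMl// mulrC ltW//.
  by move: ku; rewrite -ball_normE/= distrC.
have small_k k : (hausdorff m (lin_image T (gauss_preimage K (A k))) <=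
    r^-1%:E * \int[SK]_(u in A k) (w u)%:E)%E.
  have [->|/set0P[u0 Au0]] := eqVneq (A k) set0.
    rewrite (_ : lin_image _ _ = set0).
      rewrite hausdorff0 mule_ge0 ?lee_fin ?invr_ge0 ?(ltW r0)//.
      by apply: integral_ge0 => u _; rewrite lee_fin enorm_ge0.
    by apply/seteqP; split => x // [y [u []]].
  apply: (small _ u0) => //.
  - by move=> u /AD[[]].
  - by have [[]] := AD _ _ Au0.
  - move=> u /AD[_ /= ud]; have [_ /= u0d] := AD _ _ Au0.
    apply: le_trans (ler_enormB _ (rat_point m.+1 k) _) _.
    by rewrite (splitr delta) lerD// enormBC.
apply: (@le_trans _ _ (\sum_(k <oo) hausdorff m (lin_image T (gauss_preimage K (A k))))%E).
  apply: le_trans (hausdorff_sigma_subadditive _ _); apply: le_hausdorff.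
  move=> z /(gauss_preimage_lin uT)[x]; rewrite -/N NA gauss_preimage_bigcup => -[k _ kx] <-.
  by exists k => //; exists x.
apply: (@le_trans _ _ (\sum_(k <oo) (r^-1%:E * \int[SK]_(u in A k) (w u)%:E))%E).
  by apply: lee_nneseries => [k _ _|k _]; [exact: hausdorff_ge0|exact: small_k].
rewrite nneseriesZl; last first.
  by move=> k _; apply: integral_ge0 => u _; rewrite lee_fin enorm_ge0.
rewrite -(@ge0_integral_bigcup _ _ _ SK)//.
- by rewrite -NA.
- by rewrite -NA; exact: measurable_funTS.
- by move=> u _; rewrite lee_fin enorm_ge0.
- exact: trivIset_seqDU.
Qed.

End measure_transport.

(** * Comparison of integrals *)

Section integral_transport.
Context {R : realType} {m : nat}.
Local Notation rV := 'rV[R]_m.+1.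
Local Notation borel := (@borel_rV R m.+1).
Local Notation S := (sphere R m.+1).

(** The integral of a nonnegative function is a supremum over the simple functions below it, hence
    monotone without measurability of f or g. *)
Lemma le_integral_nonmeasurable d (X : measurableType d) (mu : {measure set X -> \bar R}) (D : set X)
    (f g : X -> \bar R) : (forall x, D x -> 0 <= f x)%E ->
  (forall x, D x -> f x <= g x)%E ->
  (\int[mu]_(x in D) f x <= \int[mu]_(x in D) g x)%E.
Proof.
move=> f0 fg; have g0 x : D x -> (0 <= g x)%E by move=> Dx; exact: le_trans (f0 _ Dx) (fg _ Dx).
rewrite !ge0_integralE//; apply: ereal_sup_le => _ [h hf <-].
exists h => // x; apply: le_trans (hf x) _; rewrite !patchE.
by case: ifPn => // /set_mem; exact: fg.
Qed.

Import HBNNSimple.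

(** A simple function h below G is pulled back by [normal_map T], and the inequality between
    measures is applied to each of its level sets. *)
Lemma integral_surface_lin_le (T : 'M[R]_m.+1) (K : set rV) (F G : rV -> R) :
  SL T -> compact K -> (forall v, S v -> 0 <= G v) ->
  (forall u, S u -> enorm (cofactor_dir T u) * G (normal_map T u) = F u) ->
  (\int[surface_area (lin_image T K)]_(v in S) (G v)%:E <=
   \int[surface_area K]_(u in S) (F u)%:E)%E.
Proof.
move=> detT K_compact G0 GF; have uT := SL_unitmx detT.
pose SK : {measure set borel -> \bar R} := surface_measure K_compact.
have TK_compact : compact (lin_image T K).
  by apply: continuous_compact => //; apply: continuous_subspaceT; exact: mulmx_continuous.
pose STK : {measure set borel -> \bar R} := surface_measure TK_compact.
pose w u := enorm (cofactor_dir T u).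
have mS : measurable (S : set borel) by apply: closed_borel; exact: closed_sphere.
suff : (\int[STK]_(v in S) (G v)%:E <= \int[SK]_(u in S) (F u)%:E)%E by [].
rewrite (@ge0_integralE _ _ _ STK S (EFin \o (G : borel -> R))); last first.
  by move=> v Sv; rewrite lee_fin G0.
apply: ge_ereal_sup => _ [h /= hG <-].
have hS u : S u -> h (normal_map T u) <= G (normal_map T u).
  move=> Su; have := hG (normal_map T u); rewrite patchE mem_set ?lee_fin//.
  exact: normal_map_sphere.
apply: (@le_trans _ _ (\int[SK]_(u in S) (h (normal_map T u) * w u)%:E)%E); last first.
  apply: (@le_integral_nonmeasurable _ _ SK) => u Su; rewrite lee_fin.
    by rewrite mulr_ge0 ?enorm_ge0.
  by rewrite -GF// mulrC ler_wpM2l ?enorm_ge0// hS.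
rewrite sintegralE.
pose P y : set borel := S `&` normal_map T @^-1` (h @^-1` [set y]).
have mP y : measurable (P y) by exact: measurable_normal_preimage.
have mw : measurable_fun setT ((EFin \o w) : borel -> \bar R).
  apply/measurable_EFinP; apply: measurable_continuous_fun.
  exact: cofactor_norm_continuous.
have wP_ge0 y u : (0 <= ((EFin \o w) \_ (P y)) u)%E.
  by rewrite patchE; case: ifP => // _; rewrite lee_fin enorm_ge0.
have mwP y : measurable_fun (S : set borel) ((EFin \o w) \_ (P y)).
  by apply: measurable_funTS; apply/(measurable_restrictT _ (mP y)); exact: measurable_funTS.
pose f (y : R) (u : borel) : \bar R := (y%:E * ((EFin \o w) \_ (P y)) u)%E.
have f0 y u : S u -> (0 <= f y u)%E.
  move=> Su; rewrite /f; have [/set_mem[_ /= <-]|uP] := boolP (u \in P y).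
    by rewrite mule_ge0// lee_fin.
  by rewrite patchE (negbTE uP) mule0.
(* At u only the level y = h(N(u)) contributes, so the pulled-back integrand is a finite sum over
   the values of h. *)
rewrite [leRHS](_ : _ = \int[SK]_(u in S) \sum_(y \in range h) f y u)%E; last first.
  apply: eq_integral => u /set_mem Su; rewrite (fsbigD1 (h (normal_map T u)))//=; last first.
    by exists (normal_map T u).
  rewrite fsbig1 ?adde0 => [|y [_ /= yh]].
    by rewrite /f patchE mem_set//= EFinM.
  rewrite /f patchE memNset ?mule0// => -[_ /= hy]; exact: yh.
rewrite ge0_integral_fsum//; last by move=> y; exact: measurable_funeM.
apply: lee_fsum => // y [v _ <-]; set y0 := h v.
rewrite /f ge0_integralZl//; last by rewrite lee_fin.
rewrite lee_wpmul2l ?lee_fin// -integral_mkcondr setIA setIid.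
exact: surface_area_lin_le.
Qed.

End integral_transport.

(** * Support and radial functions under linear maps *)

Section support_and_radial.
Context {R : realType} {n : nat}.
Implicit Types (K L Q : set 'rV[R]_n) (T : 'M[R]_n) (u v x y : 'rV[R]_n).

Lemma sup_scale (a : R) (A : set R) : 0 < a -> has_sup A ->
  sup [set a * t | t in A] = a * sup A.
Proof.
move=> a0 supA; have [[t0 At0] [M AM]] := supA.
have supaA : has_sup [set a * t | t in A].
  split; first by exists (a * t0); exists t0.
  by exists (a * M) => _ [t At <-]; rewrite ler_pM2l// AM.
apply/eqP; rewrite eq_le; apply/andP; split.
  apply: ge_sup; first by case: supaA.
  by move=> _ [t At <-]; rewrite ler_pM2l//; exact: sup_upper_bound.
rewrite -ler_pdivlMl//; apply: ge_sup; first by exists t0.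
move=> t At; rewrite ler_pdivlMl//.
by apply: (sup_upper_bound supaA); exists t.
Qed.

Lemma has_sup_support K u : compact K -> K !=set0 -> has_sup [set dot x u | x in K].
Proof.
move=> Kc [x0 Kx0]; split; first by exists (dot x0 u); exists x0.
have [M [_ KM]] := compact_bounded Kc.
exists (n%:R * (M + 1) * enorm u) => _ [x Kx <-].
apply: le_trans (dot_le_enorm _ _) _; rewrite ler_wpM2r ?enorm_ge0//.
apply: le_trans (enorm_le_norm _) _; rewrite ler_wpM2l//.
by apply: KM => //; rewrite ltrDl.
Qed.

Lemma support_fun_lin K T u : support_fun (lin_image T K) u = support_fun K (u *m T^T).
Proof.
rewrite /support_fun; congr sup; apply/seteqP; split.
  by move=> _ [_ [x Kx <-] <-]; exists x => //; rewrite dot_mulmx.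
by move=> _ [x Kx <-]; exists (x *m T); [exists x|rewrite dot_mulmx].
Qed.

Lemma support_funZ K (a : R) u : compact K -> K !=set0 -> 0 < a ->
  support_fun K (a *: u) = a * support_fun K u.
Proof.
move=> Kc K0 a0; rewrite /support_fun -sup_scale//; last exact: has_sup_support.
congr sup; apply/seteqP; split; first by move=> _ [x Kx <-]; exists (dot x u); [exists x|rewrite dotZr].
by move=> _ [_ [x Kx <-] <-]; exists x => //; rewrite dotZr.
Qed.

Lemma support_fun_gt0 K u : K0 K -> u != 0 -> 0 < support_fun K u.
Proof.
move=> [[_ Kc _] /nbhs_ballP[e /= e0 eK]] u0.
have K_0 : K 0 by apply: eK; exact: ballxx.
have nu : 0 < enorm u by rewrite enorm_gt0.
pose x := (e / 2 / enorm u) *: u.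
have xN : enorm x = e / 2.
  by rewrite enormZ gtr0_norm ?divr_gt0// divfK// gt_eqF.
have Kx : K x.
  apply: eK; rewrite -ball_normE/= sub0r normrN; apply: le_lt_trans (norm_le_enorm _) _.
  by rewrite xN gtr_pMr// invf_lt1// ltr1n.
have xu : 0 < dot x u by rewrite dotZl -enorm_sqr mulr_gt0 ?divr_gt0 ?exprn_gt0.
apply: lt_le_trans xu _; apply: sup_upper_bound; last by exists x.
by apply: has_sup_support => //; exists 0.
Qed.

Lemma polar_lin T Q : T \in unitmx ->
  polar (lin_image T Q) = lin_image (invmx T^T) (polar Q).
Proof.
move=> uT; rewrite [RHS]lin_imageE ?unitmx_inv ?unitmx_tr// invmxK.
apply/seteqP; split => y Qy x; first by move=> Qx; rewrite /= -dot_mulmx; apply: Qy; exists x.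
by move=> [z Qz <-]; rewrite dot_mulmx; exact: Qy.
Qed.

Lemma closed_polar Q : closed (polar Q).
Proof.
rewrite (_ : polar Q = \bigcap_(x in Q) [set y | dot y x <= 1]).
  apply: closed_bigI => x _.
  exact: (closed_comp (fun y _ => @dot_continuous R n x y) (@closed_le R 1)).
by apply/seteqP; split => y Qy x /Qy; rewrite /= dotC.
Qed.

Lemma K0_nonempty K : K0 K -> K !=set0.
Proof. by move=> [_ /interior_subset K_0]; exists 0. Qed.

Lemma K0_lin K T : T \in unitmx -> K0 K -> K0 (lin_image T K).
Proof.
move=> uT [[Kcvx Kc _] Kint].
have int0 : (lin_image T K)° 0.
  rewrite lin_imageE//.
  have := @mulmx_continuous _ _ _ (invmx T) 0; apply.
  by rewrite mul0mx.
split => //; split; last by exists 0.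
- move=> _ _ l /set_mem[x Kx <-] /set_mem[y Ky <-]; apply/mem_set.
  have /set_mem Kxy := Kcvx x y l (mem_set Kx) (mem_set Ky).
  by exists (conv l (x : convex_lmodType _) y) => //; rewrite /conv/= mulmxDl -!scalemxAl.
- by apply: continuous_compact => //; apply: continuous_subspaceT; exact: mulmx_continuous.
Qed.

End support_and_radial.

(** * Transport of the mixed volumes and of their admissible bodies *)

Section orlicz_transport.
Context {R : realType} {m : nat}.
Local Notation rV := 'rV[R]_m.+1.
Local Notation borel := (@borel_rV R m.+1).
Local Notation S := (sphere R m.+1).
Implicit Types (K L Q : set rV) (T : 'M[R]_m.+1) (u v : rV).

Lemma support_fun_normal_map K T u : K0 K -> T \in unitmx -> S u ->
  support_fun (lin_image T K) (normal_map T u) =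
  (enorm (cofactor_dir T u))^-1 * support_fun K u.
Proof.
move=> KK uT Su; rewrite support_fun_lin /normal_map /cofactor_dir -scalemxAl.
rewrite mulmxKV ?unitmx_tr// -/(cofactor_dir T u) support_funZ//.
- by case: KK => -[].
- exact: K0_nonempty.
- by rewrite invr_gt0 cofactor_dir_gt0.
Qed.

(* The star body whose formal polar is T L°. *)
Definition dual_image T L : set rV := lin_image (invmx T^T) L.

Lemma dual_image_ray T L (l : R) u : T \in unitmx -> S u ->
  dual_image T L (l *: normal_map T u) <-> L ((l / enorm (cofactor_dir T u)) *: u).
Proof.
move=> uT Su; rewrite /dual_image lin_imageE ?unitmx_inv ?unitmx_tr//= invmxK.
by rewrite /normal_map /cofactor_dir scalerA -scalemxAl mulmxKV// unitmx_tr.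
Qed.

Lemma S0_has_sup L u : S0 L -> S u -> has_sup [set l : R | L (l *: u)].
Proof.
move=> [_ Lrad _ _] Su; have [Lr ubr] := Lrad u Su.
by split; [exists (radial_fun L u)|exists (radial_fun L u)].
Qed.

Lemma radial_fun_dual_image T L u : S0 L -> T \in unitmx -> S u ->
  radial_fun (dual_image T L) (normal_map T u) =
  enorm (cofactor_dir T u) * radial_fun L u.
Proof.
move=> SL0 uT Su; have w0 := cofactor_dir_gt0 uT Su.
rewrite /radial_fun -sup_scale//; last exact: S0_has_sup.
congr sup; apply/seteqP; split => [l /dual_image_ray Ll|_ [l Ll <-]].
  exists (l / enorm (cofactor_dir T u)); first exact: Ll.
  by rewrite mulrC divfK// gt_eqF.
by apply/dual_image_ray => //; rewrite mulrAC divff ?gt_eqF// mul1r.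
Qed.

Lemma normal_map_surj T v : T \in unitmx -> S v ->
  S (normal_map (invmx T) v) /\ normal_map T (normal_map (invmx T) v) = v.
Proof.
move=> uT Sv; have uT' : invmx T \in unitmx by rewrite unitmx_inv.
split; first exact: normal_map_sphere.
by have := normal_mapK uT' Sv; rewrite invmxK.
Qed.

Lemma normalize_continuous u : u != 0 -> {for u, continuous (fun v => (enorm v)^-1 *: v : rV)}.
Proof.
move=> u0; have n0 : enorm u != 0 by rewrite gt_eqF// enorm_gt0.
have cV : (enorm v)^-1 @[v --> u] --> (enorm u)^-1.
  exact: (cvgV n0 (@enorm_continuous R m.+1 u)).
exact: (cvgZ cV (@cvg_id _ (nbhs u))).
Qed.

Lemma normal_map_continuous T u : T \in unitmx -> u != 0 ->
  {for u, continuous (normal_map T)}.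
Proof.
move=> uT u0; apply: (@continuous_comp _ _ _ (cofactor_dir T) (fun v => (enorm v)^-1 *: v)).
  exact: mulmx_continuous.
by apply: normalize_continuous; exact: cofactor_dir_neq0.
Qed.

(** The radial function is continuous only along the sphere. A general filter covers both limits
    within the sphere and full limits of y/|y| away from 0. *)
Lemma within_continuous_comp (X : Type) (F : set_system X) (g : X -> rV) (f : rV -> R) u :
  Filter F -> {within S, continuous f} -> S u -> g x @[x --> F] --> u ->
  (\forall x \near F, S (g x)) -> f (g x) @[x --> F] --> f u.
Proof.
move=> FF /subspace_continuousP fc Su gu Sg.
apply: (@cvg_comp _ _ _ g f F (within S (nbhs u))); last exact: fc.
move=> P /gu Pg; apply: filterS2 Sg Pg => x /= Sgx; exact.
Qed.

Lemma S0_dual_image T L : T \in unitmx -> S0 L -> S0 (dual_image T L).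
Proof.
move=> uT SL0; have [Lstar Lrad Lcont Lpos] := SL0.
have uT' : invmx T \in unitmx by rewrite unitmx_inv.
(* With u = N^-1(v), the length w(u) is the inverse of the corresponding length for T^-1 at v; the
   radial function thus becomes an expression in v that is visibly continuous and positive. *)
have radE v : S v -> radial_fun (dual_image T L) v =
    radial_fun L (normal_map (invmx T) v) / enorm (cofactor_dir (invmx T) v).
  move=> Sv; have [Su vE] := normal_map_surj uT Sv.
  rewrite -[in LHS]vE radial_fun_dual_image// mulrC; congr (_ * _).
  rewrite /normal_map {1}/cofactor_dir -scalemxAl -/(cofactor_dir T _).
  have := cofactor_dirV v uT'; rewrite invmxK => ->.
  by rewrite enormZ Sv mulr1 ger0_norm// invr_ge0 enorm_ge0.
split.
- by move=> _ t [x Lx <-] t01; exists (t *: x); [exact: Lstar|rewrite scalemxAl].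
- move=> v Sv; have [Su <-] := normal_map_surj uT Sv.
  set u := normal_map (invmx T) v in Su *.
  have w0 := cofactor_dir_gt0 uT Su; have [Lu ubu] := Lrad u Su.
  rewrite radial_fun_dual_image//; split.
    by apply/dual_image_ray => //; rewrite mulrAC divff ?gt_eqF// mul1r.
  move=> l /dual_image_ray /= Ll; rewrite mulrC -ler_pdivrMr//; apply: ubu.
  exact: Ll.
- apply/subspace_continuousP => v Sv.
  have w0 : enorm (cofactor_dir (invmx T) v) != 0 by rewrite gt_eqF// cofactor_dir_gt0.
  have [Su _] := normal_map_surj uT Sv.
  have within_nbhs (P : set rV) : nbhs v P -> within S (nbhs v) P.
    by apply: filterS => x Px _.
  have radc : radial_fun L (normal_map (invmx T) x) @[x --> within S (nbhs v)] -->
      radial_fun L (normal_map (invmx T) v).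
    apply: (@within_continuous_comp _ (within S (nbhs v)) (normal_map (invmx T)) _ _ _ Lcont Su).
      move=> P /(normal_map_continuous uT' (sphere_neq0 Sv)); exact: within_nbhs.
    by rewrite near_withinE; apply: nearW => x Sx; exact: normal_map_sphere.
  have wc : (enorm (cofactor_dir (invmx T) x))^-1 @[x --> within S (nbhs v)] -->
      (enorm (cofactor_dir (invmx T) v))^-1.
    apply: cvgV w0 _ => P /(@cofactor_norm_continuous _ _ (invmx T) v).
    exact: within_nbhs.
  have eqr : \forall x \near within S (nbhs v), radial_fun (dual_image T L) x =
      radial_fun L (normal_map (invmx T) x) / enorm (cofactor_dir (invmx T) x).
    by rewrite near_withinE; apply: nearW => x Sx; rewrite radE.
  suff : radial_fun (dual_image T L) x @[x --> within S (nbhs v)] -->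
      radial_fun (dual_image T L) v by [].
  move=> P; rewrite radE// => /(cvgM radc wc) Pr.
  by apply: filterS2 eqr Pr => x /= ->.
- move=> v Sv; rewrite radE// divr_gt0 ?Lpos ?cofactor_dir_gt0//.
  exact: normal_map_sphere.
Qed.

(** Needed for [L] to be Borel, so that its volume is preserved. Away from 0 the complement is where
    |y| exceeds the radial function at y/|y|, and the difference is continuous there. *)
Lemma closed_star_body L : S0 L -> closed L.
Proof.
move=> SL0; have [Lstar Lrad Lcont Lpos] := SL0.
pose dir (y : rV) := (enorm y)^-1 *: y.
have Sdir y : y != 0 -> S (dir y).
  move=> y0; rewrite /sphere/= enormZ ger0_norm ?invr_ge0 ?enorm_ge0// mulVf//.
  by rewrite gt_eqF// enorm_gt0.
have dirE y : y != 0 -> y = enorm y *: dir y.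
  by move=> y0; rewrite scalerA divff ?scale1r// gt_eqF// enorm_gt0.
(* Some direction has to be exhibited: 0 belongs to [L] as the endpoint of a radius. *)
have Se0 : S (e0 m) by rewrite /sphere/= /enorm dot_e0 mxE !eqxx sqrtr1.
have L0 : L 0.
  have [Lr _] := Lrad _ Se0; rewrite -(scale0r (radial_fun L (e0 m) *: e0 m)).
  by apply: Lstar => //; rewrite lexx ler01.
rewrite -[L]setCK; apply: open_closedC; rewrite openE => x Lx.
have x0 : x != 0 by apply/eqP => x_0; apply: Lx; rewrite x_0.
have rx : radial_fun L (dir x) < enorm x.
  rewrite ltNge; apply/negP => xr; apply: Lx; have r0 := Lpos _ (Sdir _ x0).
  have [Lr _] := Lrad _ (Sdir _ x0).
  rewrite (dirE _ x0) -[enorm x](divfK (lt0r_neq0 r0)) -scalerA; apply: Lstar => //.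
  by rewrite divr_ge0 ?enorm_ge0 ?(ltW r0)//= ler_pdivrMr// mul1r.
have near_neq0 : \forall y \near x, y != 0.
  have := @enorm_continuous R m.+1 x; move=> /(cvgr_gt (enorm x)) /(_ 0 (enorm_gt0 x0)).
  by apply: filterS => y; apply: contraTneq => ->; rewrite enorm0 ltxx.
have Fc : enorm y - radial_fun L (dir y) @[y --> x] --> enorm x - radial_fun L (dir x).
  have rc : radial_fun L (dir y) @[y --> x] --> radial_fun L (dir x).
    apply: (@within_continuous_comp _ (nbhs x) dir _ _ _ Lcont (Sdir _ x0)).
      exact: normalize_continuous.
    by apply: filterS near_neq0 => y; exact: Sdir.
  exact: (cvgB (@enorm_continuous R m.+1 x) rc).
have F0 : 0 < enorm x - radial_fun L (dir x) by rewrite subr_gt0.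
rewrite /interior; apply: filterS2 near_neq0 (cvgr_gt _ Fc _ F0) => y y0 Fy Ly.
have [_ /(_ (enorm y))] := Lrad _ (Sdir _ y0); rewrite /= -dirE// => /(_ Ly).
by rewrite leNgt -subr_gt0 Fy.
Qed.

Lemma Vphi_star_lin_le phi K L T : (forall t, 0 < t -> 0 < phi t) ->
  SL T -> K0 K -> S0 L ->
  (Vphi_star phi (lin_image T K) (dual_image T L) <= Vphi_star phi K L)%E.
Proof.
move=> phi0 detT KK LL; have uT := SL_unitmx detT.
rewrite /Vphi_star lee_wpmul2l ?lee_fin ?invr_ge0//.
apply: (@integral_surface_lin_le _ _ T K
  (fun u => phi (1 / (radial_fun L u * support_fun K u)) * support_fun K u)
  (fun v => phi (1 / (radial_fun (dual_image T L) v * support_fun (lin_image T K) v)) *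
     support_fun (lin_image T K) v)) => // [||u Su].
- by case: KK => -[].
- move=> v Sv; have hv := support_fun_gt0 (K0_lin uT KK) (sphere_neq0 Sv).
  have [_ _ _ /(_ v Sv) rv] := S0_dual_image uT LL.
  by rewrite mulr_ge0 ?(ltW hv)// ltW// phi0// divr_gt0// mulr_gt0.
- have w0 := cofactor_dir_gt0 uT Su.
  rewrite radial_fun_dual_image// support_fun_normal_map//.
  have -> : enorm (cofactor_dir T u) * radial_fun L u *
      ((enorm (cofactor_dir T u))^-1 * support_fun K u) = radial_fun L u * support_fun K u.
    by rewrite mulrACA divff ?mul1r// gt_eqF.
  by rewrite mulrCA mulVKf// gt_eqF.
Qed.

Lemma Vphi_lin_le phi K Q T : (forall t, 0 < t -> 0 < phi t) ->
  SL T -> K0 K -> K0 Q ->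
  (Vphi phi (lin_image T K) (lin_image T Q) <= Vphi phi K Q)%E.
Proof.
move=> phi0 detT KK QQ; have uT := SL_unitmx detT.
rewrite /Vphi lee_wpmul2l ?lee_fin ?invr_ge0//.
apply: (@integral_surface_lin_le _ _ T K
  (fun u => phi (support_fun Q u / support_fun K u) * support_fun K u)
  (fun v => phi (support_fun (lin_image T Q) v / support_fun (lin_image T K) v) *
     support_fun (lin_image T K) v)) => // [||u Su].
- by case: KK => -[].
- move=> v Sv; have hv := support_fun_gt0 (K0_lin uT KK) (sphere_neq0 Sv).
  have qv := support_fun_gt0 (K0_lin uT QQ) (sphere_neq0 Sv).
  by rewrite mulr_ge0 ?(ltW hv)// ltW// phi0// divr_gt0.
- have w0 := cofactor_dir_gt0 uT Su.
  rewrite !support_fun_normal_map//.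
  have -> : (enorm (cofactor_dir T u))^-1 * support_fun Q u /
      ((enorm (cofactor_dir T u))^-1 * support_fun K u) = support_fun Q u / support_fun K u.
    by rewrite -mulf_div divff ?mul1r// invr_eq0 gt_eqF.
  by rewrite mulrCA mulVKf// gt_eqF.
Qed.

Lemma dual_imageK T L : T \in unitmx -> dual_image (invmx T) (dual_image T L) = L.
Proof.
move=> uT; rewrite /dual_image lin_image_comp trmx_inv invmxK mulVmx ?unitmx_tr//.
exact: lin_image1.
Qed.

Lemma lin_imageK T K : T \in unitmx -> lin_image (invmx T) (lin_image T K) = K.
Proof. by move=> uT; rewrite lin_image_comp mulmxV// lin_image1. Qed.

Lemma SL_trmx_inv T : SL T -> SL (invmx T^T).
Proof. by move=> detT; apply: SL_invmx; rewrite /SL det_tr. Qed.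

Lemma Omega_values_lin_sub phi K T : (forall t, 0 < t -> 0 < phi t) ->
  SL T -> K0 K -> Omega_values phi K `<=` Omega_values phi (lin_image T K).
Proof.
move=> phi0 detT KK _ [L [LL volL] <-]; have uT := SL_unitmx detT.
exists (dual_image T L).
  split; first exact: S0_dual_image.
  by rewrite vol_SL//; [exact: SL_trmx_inv|apply: closed_borel; exact: closed_star_body].
congr (_ * _)%E; apply/eqP; rewrite eq_le Vphi_star_lin_le//=.
have := @Vphi_star_lin_le phi (lin_image T K) (dual_image T L) (invmx T) phi0
  (SL_invmx detT) (K0_lin uT KK) (S0_dual_image uT LL).
by rewrite lin_imageK// dual_imageK.
Qed.

Lemma G_values_lin_sub phi K T : (forall t, 0 < t -> 0 < phi t) ->
  SL T -> K0 K -> G_values phi K `<=` G_values phi (lin_image T K).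
Proof.
move=> phi0 detT KK _ [Q [QQ volQ] <-]; have uT := SL_unitmx detT.
exists (lin_image T Q).
  split; first exact: K0_lin.
  rewrite polar_lin// vol_SL//; first exact: SL_trmx_inv.
  by apply: closed_borel; exact: closed_polar.
congr (_ * _)%E; apply/eqP; rewrite eq_le Vphi_lin_le//=.
have := @Vphi_lin_le phi (lin_image T K) (lin_image T Q) (invmx T) phi0
  (SL_invmx detT) (K0_lin uT KK) (K0_lin uT QQ).
by rewrite !lin_imageK.
Qed.

(** Equality of the sets of values, rather than of their bounds, serves the infimum and the supremum
    alike. *)
Lemma values_lin phi K T : (forall t, 0 < t -> 0 < phi t) -> SL T -> K0 K ->
  Omega_values phi (lin_image T K) = Omega_values phi K /\
  G_values phi (lin_image T K) = G_values phi K.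
Proof.
move=> phi0 detT KK; have uT := SL_unitmx detT; have KT := K0_lin uT KK.
split; apply/seteqP; split.
- by have := Omega_values_lin_sub phi0 (SL_invmx detT) KT; rewrite lin_imageK.
- exact: Omega_values_lin_sub.
- by have := G_values_lin_sub phi0 (SL_invmx detT) KT; rewrite lin_imageK.
- exact: G_values_lin_sub.
Qed.

End orlicz_transport.

Theorem proposition3p2 (R : realType) (n : nat) (n_gt0 : (0 < n)%N)
    (K : set 'rV[R]_n) (K_K0 : K0 K) (phi : R -> R) :
  (Phi n phi -> forall T : 'M[R]_n, SL T ->
     Omega_inf phi (lin_image T K) = Omega_inf phi K /\
     G_inf phi (lin_image T K) = G_inf phi K) /\
  (Psi n phi -> forall T : 'M[R]_n, SL T ->
     Omega_sup phi (lin_image T K) = Omega_sup phi K /\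
     G_sup phi (lin_image T K) = G_sup phi K).
Proof.
(* Writing n as [m.+1] makes the dimension [n.-1] of the surface measure compute to [m]. *)
case: n n_gt0 K K_K0 => [//|m] _ K KK.
split=> -[phi0 _] T detT; have [OmegaE GE] := values_lin phi0 detT KK.
  by rewrite /Omega_inf /G_inf OmegaE GE.
by rewrite /Omega_sup /G_sup OmegaE GE.
Qed.
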